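(* Let $y$ be the solution of $\dot y(t)=f(y(t))$, $t\in[t_0,T]$, $y(t_0)=y_0\in\mathbb R^m$, let $s\ge 1$, let $h=(T-t_0)/N$, $t_n=t_0+nh$, and let $\sigma_n\in\Pi_s$ and $y_n=\sigma_n(h)$, $n=1,\dots,N$, be the polynomial approximations on $[t_{n-1},t_n]$ and the resulting grid values obtained by truncating the local Legendre expansion of the vector field to $s$ terms (see context). With $\hat\sigma_n(ch):=y(t_{n-1}+ch)$ and $\delta\sigma_n(ch):=\hat\sigma_n(ch)-\sigma_n(ch)$, $c\in[0,1]$, for $n=1,\dots,N$ one has $$y(t_n)-y_n = y(t_{n-1})-y_{n-1}+O(h^{2s+1}),\qquad \|\delta\sigma_n\|:=\max_{c\in[0,1]}|\delta\sigma_n(ch)|=O(h^{s+1}).$$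
   Context: $f:\mathbb R^m\to\mathbb R^m$ is assumed suitably regular (as smooth as needed) and $y$ is the solution on $[t_0,T]$. $|\cdot|$ is any vector norm on $\mathbb R^m$. $\Pi_s$ is the space of (here $\mathbb R^m$-valued) polynomials of degree at most $s$. $\{P_j\}_{j\ge0}$ is the orthonormal Legendre basis on $[0,1]$: $P_j$ is a polynomial of degree $j$, $\int_0^1P_i(x)P_j(x)\,dx=\delta_{ij}$, $P_0\equiv1$. For $h>0$ and a function $z:[0,h]\to\mathbb R^m$ set $\gamma_j(z):=\int_0^1P_j(\zeta)f(z(\zeta h))\,d\zeta$. The values $y_n$ and polynomials $\sigma_n:[0,h]\to\mathbb R^m$, of degree at most $s$, are defined successively for $n=1,\dots,N$, starting from $y_0$, by $$\dot\sigma_n(ch)=\sum_{j=0}^{s-1}P_j(c)\gamma_j(\sigma_n),\quad c\in[0,1],\qquad \sigma_n(0)=y_{n-1},\qquad y_n:=\sigma_n(h),$$ equivalently $\sigma_n(ch)=y_{n-1}+h\sum_{j=0}^{s-1}\int_0^cP_j(x)\,dx\,\gamma_j(\sigma_n)$ (the stepsize $h$ being small enough for $\sigma_n$ to be well defined). The $O(\cdot)$ symbols refer to $h=(T-t_0)/N\to0$, with constants uniform in $n$. *)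

(* Defs.v *)
From HB Require Import structures.
From mathcomp Require Export all_boot all_order all_algebra.
From mathcomp Require Export all_classical all_reals all_analysis.
Export Order.TTheory GRing.Theory Num.Theory.
Export numFieldNormedType.Exports.

Set Implicit Arguments.
Unset Strict Implicit.
Unset Printing Implicit Defensive.

Local Open Scope classical_set_scope.
Local Open Scope ring_scope.

(* An arbitrary vector norm on R^m, not necessarily the max norm `|_| that the
   library attaches to row vectors. *)
Record is_vnorm (R : realType) (m : nat) (nrm : 'rV[R]_m -> R) : Prop := IsVnorm {
  vnorm_triangle : forall u v, nrm (u + v) <= nrm u + nrm v;
  vnorm_scale : forall (a : R) u, nrm (a *: u) = `|a| * nrm u;
  vnorm_eq0 : forall u, nrm u = 0 -> u = 0 }.

(* Continuity is required of f and of all its iterated partial derivatives of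
   order at most k. *)
Fixpoint class_C (R : realType) (m : nat) (k : nat) (f : 'rV[R]_m -> 'rV[R]_m)
    : Prop :=
  continuous f /\
  if k is k'.+1 then
    forall i : 'I_m, (forall x, derivable f x (delta_mx 0 i)) /\
                     class_C k' (fun x => 'D_(delta_mx 0 i) f x)
  else True.

(* At the end points of [t0, T] the limit of the difference quotient is
   one-sided; y is unconstrained outside [t0, T]. *)
Definition is_solution (R : realType) (m : nat) (f : 'rV[R]_m -> 'rV[R]_m)
    (t0 T : R) (y0 : 'rV[R]_m) (y : R -> 'rV[R]_m) : Prop :=
  y t0 = y0 /\
  forall t : R, t \in `[t0, T] ->
    (u - t)^-1 *: (y u - y t) @[u --> within `[t0, T] t^'] --> f (y t).

(* These conditions determine each P j up to its sign, which is immaterial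
   below: P j always occurs together with the gamma_j computed from it. *)
Definition orthonormal_legendre (R : realType) (P : nat -> {poly R}) : Prop :=
  [/\ P 0%N = 1,
      forall j, size (P j) = j.+1 &
      forall i j, \int[lebesgue_measure]_(x in `[0%R, 1%R])
                    ((P i).[x] * (P j).[x]) = (i == j)%:R].

(* An R^m-valued polynomial is a row of m real polynomials. *)
Definition peval (R : realType) (m : nat) (sigma : 'rV[{poly R}]_m) (t : R)
    : 'rV[R]_m :=
  map_mx (fun p : {poly R} => p.[t]) sigma.

Definition pderiv (R : realType) (m : nat) (sigma : 'rV[{poly R}]_m)
    : 'rV[{poly R}]_m :=
  map_mx (fun p : {poly R} => p^`()) sigma.

Definition legendre_coef (R : realType) (m : nat) (f : 'rV[R]_m -> 'rV[R]_m)
    (P : nat -> {poly R}) (h : R) (z : R -> 'rV[R]_m) (j : nat) : 'rV[R]_m :=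
  \row_i \int[lebesgue_measure]_(x in `[0%R, 1%R])
           ((P j).[x] * f (z (x * h)) 0 i).

(* One step of length h from v.  The equation for sigma is implicit, and for a
   nonlinear f it may have, however small h is, additional solutions that move
   away from v as h tends to 0 (e.g. s = 1 and f v = v ^ 2 with m = 1).  The
   polynomial meant is the one staying near v: it is singled out by the last
   condition, whatever rho > 0 is, once h is small enough. *)
Definition legendre_step (R : realType) (m : nat) (nrm : 'rV[R]_m -> R)
    (f : 'rV[R]_m -> 'rV[R]_m) (P : nat -> {poly R}) (s : nat) (rho h : R)
    (v : 'rV[R]_m) (sigma : 'rV[{poly R}]_m) : Prop :=
  [/\ forall i, (size (sigma 0%R i) <= s.+1)%N,
      peval sigma 0 = v,
      forall c : R, c \in `[0, 1] ->
        peval (pderiv sigma) (c * h) =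
        \sum_(j < s) (P j).[c] *: legendre_coef f P h (peval sigma) j &
      forall c : R, c \in `[0, 1] -> nrm (peval sigma (c * h) - v) <= rho].

(* sigma is indexed from 1; sigma 0 is not used. *)
Definition grid_value (R : realType) (m : nat) (y0 : 'rV[R]_m) (h : R)
    (sigma : nat -> 'rV[{poly R}]_m) (n : nat) : 'rV[R]_m :=
  if n is 0%N then y0 else peval (sigma n) h.

Definition legendre_method (R : realType) (m : nat) (nrm : 'rV[R]_m -> R)
    (f : 'rV[R]_m -> 'rV[R]_m) (P : nat -> {poly R}) (s : nat) (rho h : R)
    (y0 : 'rV[R]_m) (N : nat) (sigma : nat -> 'rV[{poly R}]_m) : Prop :=
  forall n, (0 < n <= N)%N ->
    legendre_step nrm f P s rho h (grid_value y0 h sigma n.-1) (sigma n).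

(* The supremum is a maximum when g is continuous on [0, 1], as it is below. *)
Definition maxnorm (R : realType) (m : nat) (nrm : 'rV[R]_m -> R)
    (g : R -> 'rV[R]_m) : R :=
  sup [set nrm (g c) | c in `[0%R, 1%R]].

(* Main.v *)
From HB Require Import structures.
Require Import Defs.
From mathcomp Require Import all_boot all_order all_algebra.
From mathcomp Require Import all_classical all_reals all_analysis.
From mathcomp Require Import ring lra.

Set Implicit Arguments.
Unset Strict Implicit.
Unset Printing Implicit Defensive.

Local Open Scope classical_set_scope.
Local Open Scope ring_scope.

(** A step is a polynomial [sigma] whose derivative is the projection of
    [f(sigma)] on the polynomials of degree less than [s].  Its defect
    [f(sigma) - sigma'] is therefore orthogonal to these polynomials, and it is
    of size [h^s] because [sigma] is smooth uniformly in [h].  Hence the defect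
    integrated over the step against a smooth function gives only
    [h * h^s * h^s], since the function may be replaced by its distance to the
    polynomials of degree less than [s].

    Both the exact solution and the method are compared with the same explicit
    map, the Taylor polynomial of order [2s] of the flow,
    [U tau x = sum_(k <= 2s) tau^k / k! * (L^k id)(x)], where [L] is the Lie
    derivative along [f].  Along any curve [z] the derivative of
    [u |-> U (tau - u) (z u)] is [O(tau^2s)] plus the gradient of [U] applied to
    [z' - f(z)] (lemma [taylor_flow_derive]).  For the exact solution the second
    term vanishes, so [y(t + h) = U h (y t) + O(h^(2s+1))]
    ([exact_taylor_error]).  For [sigma] it is the defect tested against a
    smooth function, so that [y_n = U h y_(n-1) + O(h^(2s+1))]
    ([local_error_endpoint]).  Stopping inside the step loses the orthogonality
    and leaves [O(h^(s+1))] ([local_error_uniform]).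

    As [U h - id] is Lipschitz with a constant proportional to [h], the error
    [e_n = y(t_n) - y_n] satisfies
    [|e_n - e_(n-1)| <= B h^(2s+1) + h L |e_(n-1)|].  A discrete Gronwall
    argument gives [e_n = O(h^2s)], and inserting this bound on the right gives
    the first estimate; the second one follows because [h^2s <= h^(s+1)].

    Uniform smoothness is expressed by [jet]: a family of functions on [0,1],
    indexed by all admissible steps, has Taylor coefficients of size [h^k] and a
    remainder of size [h^l], with a constant common to the whole family.  Jets
    are stable under sums, products and composition with smooth functions
    ([jetM], [jet_comp]); that [f(sigma)] is a jet of order [s] is obtained one
    order at a time, since a jet of order [l] for [f(sigma)] gives a jet of
    order [l + 1] for [sigma] ([jet_curve_next], [jet_field]).

    Existence and uniqueness of a step come from a contraction on its Legendre
    coefficients ([step_exists], [step_unique]). The number of derivatives is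
    [3s]: [U] contains [L^2s], and its gradient must be a jet of order [s]. *)

(** * Mean values, smooth functions and the chain rule on row vectors *)

Section MatrixNorm.
Variables (R : realType) (n m : nat).
Implicit Types A : 'M[R]_(n, m).

Lemma mx_entry_le A i j : `|A i j| <= `|A|.
Proof.
by rewrite [leRHS]/Num.Def.normr/= mx_normrE; exact: (le_bigmax _ _ (i, j)).
Qed.

Lemma mx_norm_le A (M : R) : 0 <= M -> (forall i j, `|A i j| <= M) -> `|A| <= M.
Proof.
move=> M0 AM; rewrite [leLHS]/Num.Def.normr/= mx_normrE.
by apply: bigmax_le => // -[i j] _ /=.
Qed.

End MatrixNorm.

Section Coordinates.
Variables (R : realType) (m : nat).
Implicit Types (x v : 'rV[R]_m) (g : 'rV[R]_m -> R).

Lemma rV_coord_le x j : `|x 0 j| <= `|x|. Proof. exact: mx_entry_le. Qed.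

Lemma rV_norm_le x (M : R) :
  0 <= M -> (forall j, `|x 0 j| <= M) -> `|x| <= M.
Proof. by move=> M0 xM; apply: mx_norm_le => // i j; rewrite ord1. Qed.

Lemma continuous_coord j : continuous (fun x => x 0 j).
Proof. exact: coord_continuous. Qed.

Lemma is_derive_line g x v (u : R) : derivable g (u *: v + x) v ->
  is_derive u 1 (fun t : R => g (t *: v + x)) ('D_v g (u *: v + x)).
Proof.
move=> gv.
have E : (fun h : R => h^-1 *: (((fun t : R => g (t *: v + x)) \o shift u) (h *: 1)
    - g (u *: v + x))) = (fun h => h^-1 *: ((g \o shift (u *: v + x)) (h *: v)
    - g (u *: v + x))).
  by apply/funext => h /=; rewrite [_%:A]mulr1 scalerDl addrA.
by apply: DeriveDef; rewrite /derivable /derive ?E.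
Qed.

Lemma mean_value_line g x v (a : R) : (forall z, derivable g z v) ->
  exists2 b, `|b| <= `|a| /\ `|a - b| <= `|a| &
    g (a *: v + x) - g x = 'D_v g (b *: v + x) * a.
Proof.
move=> gv.
pose phi (t : R) := g (t *: v + x).
have dphi (t : R) : is_derive t 1 phi ('D_v g (t *: v + x)) by exact: is_derive_line.
have cphi (I : interval R) : {within [set` I], continuous phi}.
  by apply: derivable_within_continuous => t _; case: (dphi t).
have -> : g x = phi 0 by rewrite /phi scale0r add0r.
rewrite -/(phi a).
case: (lerP 0 a) => a0.
  have [b bi ->] := MVT_segment a0 (fun t _ => dphi t) (cphi _).
  by exists b; rewrite ?subr0 //; move: bi; rewrite in_itv/= => /andP[? ?];
    rewrite !ger0_norm ?subr_ge0//; split => //; rewrite lerBlDr lerDl.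
have [b bi E] := MVT_segment (ltW a0) (fun t _ => dphi t) (cphi _).
move: bi; rewrite in_itv/= => /andP[ab b0].
exists b; last by rewrite -[LHS]opprB E; ring.
by rewrite (ler0_norm b0) (ltr0_norm a0) ler0_norm ?subr_le0//; split; lra.
Qed.

End Coordinates.

Section MeanValue.
Variables (R : realType) (m : nat).
Implicit Types (x v : 'rV[R]_m) (g : 'rV[R]_m -> R).

(** The path that replaces the coordinates of [x] by those of [x'] one after the
    other; consecutive points differ along one axis, where the mean value
    theorem of one variable applies. *)
Definition hybrid x x' (k : nat) : 'rV[R]_m :=
  \row_j (if (j < k)%N then x' 0 j else x 0 j).

Lemma hybridS x x' (a : 'I_m) :
  hybrid x x' a.+1 = (x' 0 a - x 0 a) *: delta_mx 0 a + hybrid x x' a.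
Proof.
apply/rowP => j; rewrite !mxE eqxx /= ltnS leq_eqVlt.
case: (eqVneq a j) => [->|aj]; first by rewrite eqxx ltnn/= mulr1 subrK.
by rewrite mulr0 add0r eq_sym (inj_eq val_inj) (negbTE aj).
Qed.

(** Telescoping along the path from [x] to [x'] gives a mean value formula with
    one intermediate point per coordinate.  All these points lie in the box
    spanned by [x] and [x'], which is all that the chain rule and Lipschitz
    bounds require of them. *)
Lemma mean_value_rV g : (forall a x, derivable g x (delta_mx 0 a)) ->
  forall x x', exists xi : 'I_m -> 'rV[R]_m,
  [/\ forall a, `|xi a - x| <= `|x' - x|,
      forall a (M : R), `|x| <= M -> `|x'| <= M -> `|xi a| <= M &
      g x' - g x = \sum_a 'D_(delta_mx 0 a) g (xi a) * (x' - x) 0 a].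
Proof.
move=> dg x x'.
have /choice[b bP] : forall a : 'I_m, exists b : R,
    (`|b| <= `|x' 0 a - x 0 a| /\ `|x' 0 a - x 0 a - b| <= `|x' 0 a - x 0 a|) /\
    g (hybrid x x' a.+1) - g (hybrid x x' a) =
    'D_(delta_mx 0 a) g (b *: delta_mx 0 a + hybrid x x' a) * (x' - x) 0 a.
  move=> a; have [b Hb E] := mean_value_line (hybrid x x' a) (x' 0 a - x 0 a) (dg a).
  by exists b; split=> //; rewrite hybridS E !mxE.
exists (fun a => b a *: delta_mx 0 a + hybrid x x' a).
have cE a j : (b a *: delta_mx 0 a + hybrid x x' a) 0 j =
    if j == a then x 0 j + b a else if (j < a)%N then x' 0 j else x 0 j.
  rewrite !mxE eqxx/=; case: eqVneq => [->|_]; last by rewrite mulr0 add0r.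
  by rewrite ltnn mulr1 addrC.
split.
- move=> a; apply: rV_norm_le => // j; rewrite mxE cE [(- x) _ _]mxE.
  have H : `|x' 0 j - x 0 j| <= `|x' - x|.
    by have := rV_coord_le (x' - x) j; rewrite !mxE.
  case: eqVneq => [ja|_].
    rewrite addrAC subrr add0r (le_trans _ H)//.
    by rewrite ja; case: (bP a) => -[].
  by case: ifP => _ //; rewrite subrr normr0.
- move=> a M xM x'M; apply: rV_norm_le => [|j]; first exact: le_trans xM.
  have xj i := le_trans (rV_coord_le x i) xM.
  have x'j i := le_trans (rV_coord_le x' i) x'M.
  rewrite cE; case: eqVneq => [->|_]; last by case: ifP.
  have [[b1 b2] _] := bP a.
  move: (xj a) (x'j a) b1 b2; rewrite !ler_norml => /andP[? ?] /andP[? ?].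
  by case: (lerP 0 (x' 0 a - x 0 a)) => s; rewrite ?(ger0_norm s) ?(ltr0_norm s);
    move=> /andP[? ?] /andP[? ?]; apply/andP; split; lra.
- have h0 : hybrid x x' 0 = x by apply/rowP => j; rewrite mxE.
  have hm : hybrid x x' m = x' by apply/rowP => j; rewrite mxE ltn_ord.
  rewrite -{1}h0 -{1}hm -(telescope_sumr (fun k => g (hybrid x x' k)))//.
  by rewrite big_mkord; apply: eq_bigr => a _; case: (bP a).
Qed.

End MeanValue.

Section ContinuousPointwise.
Variables (R : realType) (T : topologicalType).
Implicit Types f g : T -> R.

Lemma continuous_add f g :
  continuous f -> continuous g -> continuous (fun x => f x + g x).
Proof. by move=> cf cg x; exact: (continuousD (cf x) (cg x)). Qed.

Lemma continuous_mul f g :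
  continuous f -> continuous g -> continuous (fun x => f x * g x).
Proof. by move=> cf cg x; exact: (continuousM (cf x) (cg x)). Qed.

Lemma cvg_sum (F : set_system T) {FF : Filter F} (I : Type) (r : seq I)
    (u : I -> T -> R) (l : I -> R) :
  (forall i, u i x @[x --> F] --> l i) ->
  (\sum_(i <- r) u i x) @[x --> F] --> \sum_(i <- r) l i.
Proof.
have cadd : continuous (fun x : R^o * R^o => x.1 + x.2) by exact: add_continuous.
by move=> ul; exact: (@cvg_big R^o I +%R 0 xpredT cadd T F r u l FF (fun i _ => ul i)).
Qed.

Lemma continuous_sum (I : Type) (r : seq I) (F : I -> T -> R) :
  (forall i, continuous (F i)) -> continuous (fun x => \sum_(i <- r) F i x).
Proof. by move=> cF x; apply: (@cvg_sum (nbhs x)) => i; exact: cF. Qed.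

End ContinuousPointwise.

Section Smooth.
Variables (R : realType) (m : nat).
Implicit Types (x v : 'rV[R]_m) (g : 'rV[R]_m -> R).

Definition partial (a : 'I_m) g : 'rV[R]_m -> R := fun x => 'D_(delta_mx 0 a) g x.

(** Scalar counterpart of [class_C], for which products make sense: the iterated
    Lie derivatives below are sums of products. *)
Fixpoint smooth (k : nat) g : Prop :=
  continuous g /\
  if k is k'.+1 then
    forall a, (forall x, derivable g x (delta_mx 0 a)) /\ smooth k' (partial a g)
  else True.

Lemma smooth_continuous k g : smooth k g -> continuous g.
Proof. by case: k => [|k] []. Qed.

Lemma smooth_derivable k g :
  smooth k.+1 g -> forall a x, derivable g x (delta_mx 0 a).
Proof. by case=> _ dg a; case: (dg a). Qed.
Arguments smooth_derivable {k g} _ a x.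

Lemma smooth_partial k g a : smooth k.+1 g -> smooth k (partial a g).
Proof. by case=> _ /(_ a)[]. Qed.

Lemma smoothS k g : smooth k.+1 g -> smooth k g.
Proof.
elim: k g => [|k IHk] g [cg dg]; first by split.
by split => // a; have [? ?] := dg a; split => //; exact: IHk.
Qed.

Lemma smooth_le k l g : (l <= k)%N -> smooth k g -> smooth l g.
Proof.
move/subnK <-; elim: (k - l)%N => // d IHd.
by rewrite addSn => /smoothS.
Qed.

Lemma smooth_cst k (c : R) : smooth k (fun=> c).
Proof.
elim: k c => [|k IHk] c; split => //; try exact: cst_continuous.
move=> a; split => [x|]; first exact: derivable_cst.
rewrite (_ : partial a _ = fun=> 0) //.
by apply/funext => x; exact: derive_cst.
Qed.

Lemma is_derive_coord (j : 'I_m) x v : is_derive x v (fun z : 'rV[R]_m => z 0 j) (v 0 j).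
Proof.
have E : (fun h : R => h^-1 *: (((fun z : 'rV[R]_m => z 0 j) \o shift x) (h *: v)
    - x 0 j)) @ 0^' --> v 0 j.
  apply: (@cvg_near_cst _ _ _ (fun h : R =>
    h^-1 *: (((fun z : 'rV[R]_m => z 0 j) \o shift x) (h *: v) - x 0 j))).
  near=> h; rewrite /= !mxE addrK [_ *: _]mulrA mulVf ?mul1r//.
  by near: h; exact: nbhs_dnbhs_neq.
by apply: DeriveDef; [by apply/cvg_ex; exists (v 0 j)|exact/cvg_lim].
Unshelve. all: by end_near. Qed.

Lemma smooth_coord k (j : 'I_m) : smooth k (fun x => x 0 j).
Proof.
case: k => [|k]; split => //; try exact: continuous_coord.
move=> a; split => [x|]; first by have [] := is_derive_coord j x (delta_mx 0 a).
rewrite (_ : partial a _ = fun=> (delta_mx 0 a : 'rV[R]_m) 0 j); first exact: smooth_cst.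
by apply/funext => x; case: (is_derive_coord j x (delta_mx 0 a)).
Qed.

Lemma smoothD k f g : smooth k f -> smooth k g -> smooth k (fun x => f x + g x).
Proof.
elim: k f g => [|k IHk] f g [cf df] [cg dg]; split => //;
  try exact: continuous_add.
move=> a; have [df1 df2] := df a; have [dg1 dg2] := dg a.
split => [x|]; first exact: derivableD.
rewrite (_ : partial a _ = fun x => partial a f x + partial a g x); first exact: IHk.
by apply/funext => x; exact: deriveD.
Qed.

Lemma smoothM k f g : smooth k f -> smooth k g -> smooth k (fun x => f x * g x).
Proof.
elim: k f g => [|k IHk] f g sf sg; split => //;
  try by apply: continuous_mul; apply: smooth_continuous; eassumption.
move=> a; split => [x|].
  by apply: derivableM; [exact: (smooth_derivable sf a x)|exact: (smooth_derivable sg a x)].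
rewrite (_ : partial a _ = fun x => f x * partial a g x + g x * partial a f x).
  by apply: smoothD; apply: IHk;
    by [exact: smoothS|exact: smooth_partial].
by apply/funext => x;
  apply: deriveM; [exact: (smooth_derivable sf a x)|exact: (smooth_derivable sg a x)].
Qed.

Lemma smooth_sum k (I : Type) (r : seq I) (F : I -> 'rV[R]_m -> R) :
  (forall i, smooth k (F i)) -> smooth k (fun x => \sum_(i <- r) F i x).
Proof.
move=> sF; elim: r => [|i r IHr].
  by under eq_fun do rewrite big_nil; exact: smooth_cst.
by under eq_fun do rewrite big_cons; exact: smoothD.
Qed.

Lemma bounded_on_ball g (M : R) : continuous g ->
  exists2 B, 0 <= B & forall x, `|x| <= M -> `|g x| <= B.
Proof.
move=> cg; case: (lerP 0 M) => M0; last first.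
  by exists 0 => // x xM; have := le_trans (normr_ge0 x) xM; rewrite leNgt M0.
pose A := [set x : 'rV[R]_m | forall i, `[- M, M]%classic (x 0 i)].
have cA : compact A.
  by apply: (@rV_compact R m (fun=> `[- M, M]%classic)) => i; exact: segment_compact.
have AP x : `|x| <= M -> A x.
  by move=> xM i /=; rewrite in_itv/= -ler_norml (le_trans (rV_coord_le _ _)).
have [c _ cmax] : exists2 c, c \in A & forall t, t \in A -> `|g t| <= `|g c|.
  apply: (@compact_EVT_max _ R (fun x => `|g x|)) => //.
    by exists 0; apply: AP; rewrite normr0.
  apply: continuous_subspaceT => x.
  by apply: (cvg_comp _ _ (cg x)); exact: norm_continuous.
by exists `|g c| => // x /AP Ax; apply: cmax; rewrite inE.
Qed.

Lemma lipschitz_on_ball g (M : R) : smooth 1 g ->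
  exists2 L, 0 <= L &
    forall x x', `|x| <= M -> `|x'| <= M -> `|g x' - g x| <= L * `|x' - x|.
Proof.
move=> sg.
have /choice[B BP] : forall a, exists B,
    0 <= B /\ forall x, `|x| <= M -> `|partial a g x| <= B.
  move=> a; have [|B B0 HB] := @bounded_on_ball (partial a g) M; last by exists B.
  by apply: smooth_continuous (smooth_partial _ sg).
exists (\sum_a B a); first by apply: sumr_ge0 => a _; case: (BP a).
move=> x x' xM x'M.
have [xi [_ xiM ->]] := mean_value_rV (smooth_derivable sg) x x'.
rewrite mulr_suml; apply: le_trans (ler_norm_sum _ _ _) _.
apply: ler_sum => a _; rewrite normrM ler_pM//; last exact: rV_coord_le.
by case: (BP a) => _; apply; exact: xiM.
Qed.

(** In the formula of [mean_value_rV] between [z t] and [z (t + h)] the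
    intermediate points tend to [z t], so continuity of the partial derivatives
    gives the limit of the difference quotient. *)
Lemma chain_rule g (z : R -> 'rV[R]_m) (dz : 'I_m -> R) (t : R) : smooth 1 g ->
  (forall a, is_derive t 1 (fun u => z u 0 a) (dz a)) ->
  is_derive t 1 (fun u => g (z u)) (\sum_a partial a g (z t) * dz a).
Proof.
move=> sg dzP.
have /choice[xi xiP] : forall h : R, exists xi : 'I_m -> 'rV[R]_m,
  (forall a, `|xi a - z t| <= `|z (h *: 1 + t) - z t|) /\
   g (z (h *: 1 + t)) - g (z t) = \sum_a partial a g (xi a) * (z (h *: 1 + t) - z t) 0 a.
  move=> h.
  have [xi [? _ ?]] := mean_value_rV (smooth_derivable sg) (z t) (z (h *: 1 + t)).
  by exists xi.
(* The intermediate points are squeezed between [z t] and [z (t + h)]. *)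
have cz : z (h *: 1 + t) @[h --> (0:R)^'] --> z t.
  have dz0 : derivable z t 1.
    by apply/derivable_mxP => i j; rewrite ord1; case: (dzP j).
  move/derivable1_diffP/differentiable_continuous : dz0 => cz.
  have : (h *: 1 + t) @[h --> (0:R)^'] --> t.
    rewrite -{2}[t]add0r; apply: cvgD; last exact: cvg_cst.
    rewrite -[X in _ --> X](scale0r (1:R)).
    apply: cvgZr_tmp; exact: nbhs_dnbhs.
  by move/cvg_comp; apply.
have xic a : xi h a @[h --> (0:R)^'] --> z t.
  apply/cvgrPdist_le => e e0; move/cvgrPdist_le : cz => /(_ e e0).
  apply: filterS => h; rewrite distrC => H; rewrite distrC.
  by apply: le_trans H; case: (xiP h).
have qE : (fun h : R => h^-1 *: (((fun u => g (z u)) \o shift t) (h *: 1) - g (z t)))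
   = (fun h : R => \sum_a partial a g (xi h a) * (h^-1 *: (z (h *: 1 + t) 0 a - z t 0 a))).
  apply/funext => h /=; have [_ ->] := xiP h.
  rewrite scaler_sumr; apply: eq_bigr => a _.
  by rewrite -[_ *: _]/(_ * _) mulrCA !mxE.
have E : (h^-1 *: (((fun u => g (z u)) \o shift t) (h *: 1) - g (z t)))
     @[h --> (0:R)^'] --> \sum_a partial a g (z t) * dz a.
  rewrite qE; apply: cvg_sum => a; apply: cvgM.
    have cp : {for z t, continuous (partial a g)}.
      exact: (smooth_continuous (smooth_partial a sg)).
    exact: (continuous_cvg _ cp (xic a)).
  by have [+ <-] := dzP a.
by apply: DeriveDef; [apply/cvg_ex; eexists; exact: E|exact/cvg_lim].
Qed.

End Smooth.

Lemma class_C_smooth (R : realType) (m k : nat) (f : 'rV[R]_m -> 'rV[R]_m) i :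
  class_C k f -> smooth k (fun x => f x 0 i).
Proof.
elim: k f => [|k IHk] f [cf df]; split => //.
- by move=> x; exact: (continuous_cvg _ (@continuous_coord R m i (f x)) (cf x)).
- by move=> x; exact: (continuous_cvg _ (@continuous_coord R m i (f x)) (cf x)).
move=> a; have [d1 d2] := df a; split => [x|].
  by move: (d1 x) => /derivable_mxP.
rewrite (_ : partial a _ = fun x => 'D_(delta_mx 0 a) f x 0 i); first exact: IHk.
by apply/funext => x; rewrite derive_mx// mxE.
Qed.

(** * Integrals over the unit interval and polynomials *)

Section UnitInterval.
Variable R : realType.
Implicit Types f g : R -> R.

Definition int01 f : R := \int[lebesgue_measure]_(x in `[0%R, 1%R]) f x.

Lemma integrable01 f : continuous f ->
  (@lebesgue_measure R).-integrable `[0%R, 1%R] (EFin \o f).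
Proof.
move=> cf; apply: continuous_compact_integrable; first exact: segment_compact.
exact: continuous_subspaceT.
Qed.

Lemma int01D f g : continuous f -> continuous g ->
  int01 (fun x => f x + g x) = int01 f + int01 g.
Proof. by move=> cf cg; apply: RintegralD => //; exact: integrable01. Qed.

Lemma int01Z f (r : R) : continuous f -> int01 (fun x => r * f x) = r * int01 f.
Proof. by move=> cf; apply: RintegralZl => //; exact: integrable01. Qed.

Lemma int01_cst (r : R) : int01 (fun=> r) = r.
Proof.
by rewrite /int01 Rintegral_cst//= lebesgue_measure_itv/= lte01 EFinN sube0 mulr1.
Qed.

Lemma int01_sum (I : Type) (r : seq I) (F : I -> R -> R) :
  (forall i, continuous (F i)) ->
  int01 (fun x => \sum_(i <- r) F i x) = \sum_(i <- r) int01 (F i).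
Proof.
move=> cF; elim: r => [|i r IHr].
  by rewrite big_nil; under eq_fun do rewrite big_nil; exact: int01_cst.
rewrite big_cons -IHr -int01D//; last exact: continuous_sum.
by under eq_fun do rewrite big_cons.
Qed.

Lemma eq_int01 f g : (forall x, 0 <= x <= 1 -> f x = g x) -> int01 f = int01 g.
Proof.
by move=> fg; apply: eq_Rintegral => x; rewrite inE/= in_itv/= => /fg.
Qed.

Lemma int01_bound f (B : R) : continuous f ->
  (forall x, 0 <= x <= 1 -> `|f x| <= B) -> `|int01 f| <= B.
Proof.
move=> cf fB; apply: le_trans (le_normr_Rintegral _ (integrable01 cf)) _ => //.
rewrite -[leRHS](int01_cst B); apply: le_Rintegral => //.
- apply: (@integrable01 (fun x => `|f x|)) => x.
  exact: (continuous_cvg _ (@norm_continuous _ R^o (f x)) (cf x)).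
- exact: integrable01 (@cst_continuous _ _ B).
Qed.

Lemma int01_derive F f : (forall x, is_derive (x : R) 1 F (f x)) ->
  continuous f -> int01 f = F 1 - F 0.
Proof.
move=> dF cf; have dF' x : derivable F x 1 by case: (dF x).
have cF : continuous F.
  by move=> x; exact/differentiable_continuous/derivable1_diffP/dF'.
rewrite /int01 /Rintegral (@continuous_FTC2 _ f F)//.
- exact: continuous_subspaceT.
- split=> [x _||]; first exact: dF'.
  + by apply: cvg_at_right_filter; exact: cF.
  + by apply: cvg_at_left_filter; exact: cF.
- by move=> x _; rewrite derive1E; case: (dF x).
Qed.

Lemma mean_value_bound F f (a b B : R) : a <= b ->
  (forall x, a < x < b -> is_derive (x : R) 1 F (f x)) ->
  {within `[a, b], continuous F} ->
  (forall x, a <= x <= b -> `|f x| <= B) -> `|F b - F a| <= B * (b - a).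
Proof.
move=> ab dF cF fB.
have dF' x : x \in `]a, b[%R -> is_derive (x : R) 1 F (f x).
  by rewrite in_itv/=; exact: dF.
have [c cab ->] := MVT_segment ab dF' cF.
rewrite normrM (ger0_norm (_ : 0 <= b - a)) ?subr_ge0// ler_wpM2r ?subr_ge0//.
by apply: fB; move: cab; rewrite in_itv.
Qed.

End UnitInterval.

Section Primitive.
Variable R : realType.
Implicit Types p q : {poly R}.

(** Antiderivative vanishing at 0; the entry of index 0 is a division by 0,
    which is 0. *)
Definition primp p : {poly R} := \poly_(i < (size p).+1) (p`_i.-1 / i%:R).

Lemma coef_primp p i : (primp p)`_i = if i is j.+1 then p`_j / i%:R else 0.
Proof.
rewrite coef_poly; case: i => [|i]; first by rewrite invr0 mulr0.
by case: ltnP => //= pi; rewrite nth_default ?mul0r.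
Qed.

Lemma size_primp p : (size (primp p) <= (size p).+1)%N.
Proof. exact: size_poly. Qed.

Lemma primpK p : (primp p)^`() = p.
Proof.
apply/polyP => i; rewrite coef_deriv coef_primp -[LHS]mulr_natr divfK//.
Qed.

Lemma primp0 p : (primp p).[0] = 0.
Proof. by rewrite horner_coef0 coef_primp. Qed.

Lemma poly_deriv_eq p q : p^`() = q^`() -> p.[0] = q.[0] -> p = q.
Proof.
move=> /polyP pq p0; apply/polyP => -[|i]; first by rewrite -!horner_coef0.
have := pq i; rewrite !coef_deriv -[LHS]mulr_natr -[RHS]mulr_natr.
by apply: mulIf; rewrite pnatr_eq0.
Qed.

(** The points [1 / (i + 1)] provide more roots of [p - q] than its degree. *)
Lemma poly_eq_on01 p q :
  (forall c : R, 0 <= c <= 1 -> p.[c] = q.[c]) -> p = q.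
Proof.
move=> pq; apply/eqP; rewrite -subr_eq0; apply/negPn/negP => d0.
pose n := size (p - q).
pose rs : seq R := [seq i.+1%:R^-1 | i <- iota 0 n].
have := max_poly_roots d0 (_ : all (root (p - q)) rs) _.
rewrite size_map size_iota ltnn => H.
suff : false by []; apply: H.
  apply/allP => _ /mapP[i _ ->]; rewrite /root hornerD hornerN pq ?subrr//.
  by rewrite invr_ge0 ler0n/= invf_le1 ?ltr0n// ler1n.
rewrite map_inj_uniq ?iota_uniq// => i j /= ij.
by move/eqP: (GRing.invr_inj ij); rewrite eqr_nat => /eqP[].
Qed.

End Primitive.

Lemma mul_continuous_horner (R : realType) (f : R -> R) (p : {poly R}) :
  continuous f -> continuous (fun x => p.[x] * f x).
Proof. by move=> cf; apply: continuous_mul => //; exact: continuous_horner. Qed.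

Lemma horner_bound (R : realType) (p : {poly R}) n (b c : R) :
  (size p <= n)%N -> (forall k, `|p`_k| <= b) -> 0 <= c <= 1 ->
  `|p.[c]| <= n%:R * b.
Proof.
move=> sp pb /andP[c0 c1]; rewrite (horner_coef_wide _ sp).
apply: le_trans (ler_norm_sum _ _ _) _.
rewrite mulr_natl -[X in _ *+ X]card_ord -sumr_const; apply: ler_sum => i _.
rewrite normrM -[leRHS]mulr1; apply: ler_pM => //.
by rewrite normrX (ger0_norm c0) exprn_ile1.
Qed.

(** * Legendre expansions *)

Section Projection.
Variables (R : realType) (P : nat -> {poly R}) (s : nat).
Hypothesis orthoP : orthonormal_legendre P.

Lemma legendre_span n (p : {poly R}) : (size p <= n)%N ->
  exists b : nat -> R, p = \sum_(j < n) b j *: P j.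
Proof.
have [_ sP _] := orthoP.
elim: n p => [|n IHn] p.
  by rewrite leqn0 size_poly_eq0 => /eqP ->; exists (fun=> 0); rewrite big_ord0.
move=> sp; pose a := p`_n / lead_coef (P n).
have lP : lead_coef (P n) != 0 by rewrite lead_coef_eq0 -size_poly_eq0 sP.
have [|b Eb] := IHn (p - a *: P n).
  apply/leq_sizeP => j; rewrite leq_eqVlt => /predU1P[<-|nj].
    by rewrite coefB coefZ -[(P n)`_n]/((P n)`_n.+1.-1) -(sP n) divfK ?subrr.
  rewrite coefB coefZ !nth_default ?mulr0 ?subrr ?sP//.
  exact: leq_trans sp nj.
exists (fun j => if j == n then a else b j).
rewrite big_ord_recr/= eqxx -[LHS](subrK (a *: P n)) Eb; congr (_ + _).
by apply: eq_bigr => j _; rewrite ltn_eqF.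
Qed.

(** The coefficients in the basis [P] are read off by orthonormality. *)
Lemma legendre_expansion (p : {poly R}) : (size p <= s)%N ->
  p = \sum_(j < s) int01 (fun x => (P j).[x] * p.[x]) *: P j.
Proof.
move=> sp; have [b Eb] := legendre_span sp.
rewrite {1}Eb; apply: eq_bigr => j _; congr (_ *: _).
have [_ _ oP] := orthoP.
rewrite Eb (_ : (fun x => _) =
    fun x => \sum_(i < s) b i * ((P j).[x] * (P i).[x])); last first.
  apply/funext => x; rewrite horner_sum mulr_sumr; apply: eq_bigr => i _.
  by rewrite hornerZ mulrCA.
have cPP i : continuous (fun x => (P j).[x] * (P i).[x]).
  by apply: mul_continuous_horner; exact: continuous_horner.
rewrite int01_sum => [|i]; last first.
  by apply: continuous_mul => //; exact: cst_continuous.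
rewrite (eq_bigr (fun i : 'I_s => b i * (i == j)%:R)) => [|i _]; last first.
  by rewrite int01Z// /int01 oP eq_sym.
rewrite (bigD1 j)//= eqxx mulr1 big1 ?addr0// => i /negbTE ij.
by rewrite ij mulr0.
Qed.

Lemma legendre_bound : exists2 B : R, 0 <= B & forall j, (j < s)%N ->
  (forall k, `|(P j)`_k| <= B) /\ (forall c, 0 <= c <= 1 -> `|(P j).[c]| <= B).
Proof.
have [_ sP _] := orthoP.
pose b j := \sum_(k < j.+1) `|(P j)`_k|.
have b0 j : 0 <= b j by apply: sumr_ge0.
have bP j k : `|(P j)`_k| <= b j.
  have [kj|jk] := ltnP k j.+1; last by rewrite nth_default ?normr0 ?sP.
  by rewrite /b (bigD1 (Ordinal kj))//= lerDl sumr_ge0.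
exists (\sum_(j < s) j.+1%:R * b j) => [|j js].
  by apply: sumr_ge0 => j _; rewrite mulr_ge0.
have H : j.+1%:R * b j <= \sum_(j < s) j.+1%:R * b j.
  rewrite (bigD1 (Ordinal js))//= lerDl sumr_ge0// => i _.
  by rewrite mulr_ge0.
split => [k|c c01]; apply: le_trans H.
  by rewrite (le_trans (bP j k))// ler_peMl// ler1n.
by apply: horner_bound => //; rewrite sP.
Qed.

Definition legendre_projection (F : R -> R) : {poly R} :=
  \sum_(j < s) int01 (fun x => (P j).[x] * F x) *: P j.

Lemma size_projection F : (size (legendre_projection F) <= s)%N.
Proof.
have [_ sP _] := orthoP.
apply: (leq_trans (size_sum _ _ _)); apply/bigmax_leqP => j _.
by rewrite (leq_trans (size_scale_leq _ _))// sP.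
Qed.

Lemma size_step (h : R) (p : {poly R}) F :
  p^`() = h *: legendre_projection F -> (size p <= s.+1)%N.
Proof.
move=> /polyP pE; apply/leq_sizeP => -[//|k] sk; have := pE k.
rewrite coef_deriv coefZ [X in _ * X]nth_default; last first.
  exact: leq_trans (size_projection F) _.
by rewrite mulr0 => /eqP; rewrite mulrn_eq0 => /eqP.
Qed.

Lemma projection_orthogonal (F : R -> R) (p : {poly R}) : continuous F ->
  (size p <= s)%N -> int01 (fun x => p.[x] * (F x - (legendre_projection F).[x])) = 0.
Proof.
move=> cF sp; have [b ->] := legendre_span sp.
have cG : continuous (fun x => F x - (legendre_projection F).[x]).
  apply: continuous_add => // x.
  exact: (continuousN (@continuous_horner _ (legendre_projection F) x)).
have -> : (fun x => (\sum_(j < s) b j *: P j).[x] * (F x - (legendre_projection F).[x])) =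
    fun x => \sum_(j < s) b j * ((P j).[x] * (F x - (legendre_projection F).[x])).
  apply/funext => x; rewrite horner_sum mulr_suml; apply: eq_bigr => j _.
  by rewrite hornerZ mulrA.
rewrite int01_sum => [|j]; last first.
  by apply: continuous_mul; [exact: cst_continuous|exact: mul_continuous_horner].
apply: big1 => j _; rewrite int01Z; last exact: mul_continuous_horner.
have -> : (fun x => (P j).[x] * (F x - (legendre_projection F).[x])) =
    fun x => (P j).[x] * F x + (-1) * ((P j).[x] * (legendre_projection F).[x]).
  by apply/funext => x; ring.
have cPQ (q : {poly R}) : continuous (fun x => (P j).[x] * q.[x]).
  by apply: mul_continuous_horner; exact: continuous_horner.
rewrite int01D; [|exact: mul_continuous_horner|]; last first.
  by apply: continuous_mul; [exact: cst_continuous|exact: cPQ].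
rewrite int01Z//.
have -> : int01 (fun x => (P j).[x] * (legendre_projection F).[x]) =
    int01 (fun x => (P j).[x] * F x); last by ring.
have -> : (fun x => (P j).[x] * (legendre_projection F).[x]) =
  fun x => \sum_(i < s) int01 (fun x => (P i).[x] * F x) * ((P j).[x] * (P i).[x]).
  apply/funext => x; rewrite horner_sum mulr_sumr; apply: eq_bigr => i _.
  by rewrite hornerZ mulrCA.
rewrite int01_sum => [|i]; last first.
  by apply: continuous_mul; [exact: cst_continuous|exact: cPQ].
have [_ _ oP] := orthoP.
rewrite (bigD1 j)//= big1 => [|i /negbTE ij].
  by rewrite int01Z// /int01 oP eqxx mulr1 addr0.
by rewrite int01Z// {2}/int01 oP eq_sym (inj_eq val_inj) ij mulr0.
Qed.

End Projection.

(** * Jets: uniform smoothness of families of functions *)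

Lemma is_derive_peval (R : realType) m (S : 'rV[{poly R}]_m) a (c : R) :
  is_derive c 1 (fun u => peval S u 0 a) (S 0 a)^`().[c].
Proof.
have -> : (fun u => peval S u 0 a) = horner (S 0 a).
  by apply/funext => u; rewrite mxE.
exact: is_derive_poly.
Qed.

Section Jets.
Variables (R : realType) (I : Type) (h : I -> R).
Hypothesis h01 : forall i, 0 < h i <= 1.
Implicit Types F G : I -> R -> R.

(** The index [i] runs over all the steps under consideration, so that [B] is
    uniform.  The functions are rescaled to [0,1]: a Taylor expansion in [c * h i]
    with bounded coefficients has its coefficient of degree [k] in [c] of size
    [h i ^ k].  This size makes the terms discarded in a product negligible. *)
Definition jet (l : nat) F : Prop :=
  exists2 B : R, 0 <= B & exists q : I -> {poly R},
  [/\ forall i, (size (q i) <= l)%N,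
      forall i k, `|(q i)`_k| <= B * h i ^+ k &
      forall i c, 0 <= c <= 1 -> `|F i c - (q i).[c]| <= B * h i ^+ l].

Lemma h_ge0 i : 0 <= h i. Proof. by case/andP: (h01 i) => /ltW. Qed.
Lemma h_le1 i : h i <= 1. Proof. by case/andP: (h01 i). Qed.
Lemma hX_ge0 i k : 0 <= h i ^+ k. Proof. exact/exprn_ge0/h_ge0. Qed.

Lemma hX_le i k l : (l <= k)%N -> h i ^+ k <= h i ^+ l.
Proof. by move=> lk; apply: ler_wiXn2l => //; [exact: h_ge0|exact: h_le1]. Qed.

Lemma eq_jet l F G : (forall i c, 0 <= c <= 1 -> F i c = G i c) ->
  jet l F -> jet l G.
Proof.
move=> FG [B B0 [q [sq qB Fq]]]; exists B => //; exists q; split => // i c c01.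
by rewrite -FG//; exact: Fq.
Qed.

Lemma jet_small l F (B : R) : 0 <= B ->
  (forall i c, 0 <= c <= 1 -> `|F i c| <= B * h i ^+ l) -> jet l F.
Proof.
move=> B0 FB; exists B => //; exists (fun=> 0); split => [i|i k|i c c01].
- by rewrite size_poly0.
- by rewrite coef0 normr0 mulr_ge0// hX_ge0.
- by rewrite horner0 subr0; exact: FB.
Qed.

Lemma jetD l F G : jet l F -> jet l G -> jet l (fun i c => F i c + G i c).
Proof.
move=> [B B0 [q [sq qB Fq]]] [C C0 [r [sr rC Gr]]].
exists (B + C); first exact: addr_ge0.
exists (fun i => q i + r i); split => [i|i k|i c c01].
- by rewrite (leq_trans (size_polyD _ _))// geq_max sq sr.
- by rewrite coefD mulrDl (le_trans (ler_normD _ _))// lerD.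
- rewrite hornerD opprD addrACA mulrDl (le_trans (ler_normD _ _))// lerD//.
    exact: Fq.
  exact: Gr.
Qed.

Lemma jet_sum l (J : Type) (r : seq J) (F : J -> I -> R -> R) :
  (forall j, jet l (F j)) -> jet l (fun i c => \sum_(j <- r) F j i c).
Proof.
move=> jF; elim: r => [|j r IHr].
  apply: (@jet_small _ _ 0) => // i c _.
  by rewrite big_nil normr0 mul0r.
by apply: eq_jet (jetD (jF j) IHr) => i c _; rewrite big_cons.
Qed.

(** Coefficients of degree at least [l] may be as large as [h^l]: they go into
    the remainder. *)
Lemma jet_poly l n (p : I -> {poly R}) (B : R) : 0 <= B ->
  (forall i, (size (p i) <= n)%N) ->
  (forall i k, `|(p i)`_k| <= B * h i ^+ minn k l) ->
  jet l (fun i c => (p i).[c]).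
Proof.
move=> B0 sp pB; exists (n.+1%:R * B); first exact: mulr_ge0.
exists (fun i => take_poly l (p i)); split => [i|i k|i c c01].
- exact: size_take_poly.
- rewrite coef_take_poly; case: ifP => [kl|_]; last first.
    by rewrite normr0 !mulr_ge0// hX_ge0.
  have := pB i k; rewrite (minn_idPl (ltnW kl)) => /le_trans; apply.
  by rewrite ler_wpM2r ?hX_ge0// ler_peMl// ler1n.
- rewrite -hornerN -hornerD -mulrA.
  have : `|(p i - take_poly l (p i)).[c]| <= n%:R * (B * h i ^+ l).
    apply: horner_bound => // [|k].
      rewrite (leq_trans (size_polyD _ _))// size_polyN geq_max sp/=.
      apply/leq_sizeP => j nj; rewrite coef_take_poly nth_default ?if_same//.
      exact: leq_trans nj.
    rewrite coefB coef_take_poly; case: ltnP => kl.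
      by rewrite subrr normr0 mulr_ge0// hX_ge0.
    by rewrite subr0; have := pB i k; rewrite (minn_idPr kl).
  move/le_trans; apply; rewrite ler_wpM2r ?mulr_ge0 ?hX_ge0//.
  by rewrite ler_nat.
Qed.

Lemma jet_bounded l F : jet l F ->
  exists2 B, 0 <= B & forall i c, 0 <= c <= 1 -> `|F i c| <= B.
Proof.
move=> [B B0 [q [sq qB Fq]]]; exists (B + l%:R * B) => [|i c c01].
  by rewrite addr_ge0// mulr_ge0.
have hB k : B * h i ^+ k <= B.
  by rewrite ler_piMr// exprn_ile1// ?h_ge0 ?h_le1.
rewrite -[F i c](subrK (q i).[c]) (le_trans (ler_normD _ _))// lerD//.
  exact: le_trans (Fq _ _ c01) (hB _).
by apply: horner_bound => // k; exact: le_trans (qB _ _) (hB _).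
Qed.

(** The product of the two polynomial parts has degree up to [2l], but its
    coefficients have the size required by [jet_poly]; the remainders are
    multiplied by bounded functions. *)
Lemma jetM l F G : jet l F -> jet l G -> jet l (fun i c => F i c * G i c).
Proof.
move=> jF jG.
have [CG CG0 GB] := jet_bounded jG.
have [B B0 [q [sq qB Fq]]] := jF; have [C C0 [r [sr rC Gr]]] := jG.
have jqr : jet l (fun i c => (q i * r i).[c]).
  apply: (@jet_poly _ (l + l) _ ((l + l)%:R * (B * C))) => [|i|i k].
  - by rewrite !mulr_ge0.
  - rewrite (leq_trans (size_polyMleq _ _))// (leq_trans (leq_pred _))//.
    exact: leq_add.
  - have [kl|lk] := leqP (l + l) k.
      rewrite nth_default ?normr0 ?mulr_ge0// ?hX_ge0//.
      rewrite (leq_trans (size_polyMleq _ _))// (leq_trans (leq_pred _))//.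
      by rewrite (leq_trans _ kl)// leq_add.
    rewrite coefM (le_trans (ler_norm_sum _ _ _))//.
    apply: (@le_trans _ _ (\sum_(j < k.+1) (B * C * h i ^+ minn k l))).
      apply: ler_sum => j _; rewrite normrM.
      apply: (@le_trans _ _ (B * h i ^+ j * (C * h i ^+ (k - j)))).
        exact: ler_pM.
      have jk : (j <= k)%N by rewrite -ltnS.
      rewrite mulrACA -exprD (subnKC jk) ler_wpM2l ?mulr_ge0//.
      exact/hX_le/geq_minl.
    rewrite sumr_const card_ord -[leLHS]mulr_natl -[leRHS]mulrA.
    by rewrite ler_wpM2r ?mulr_ge0 ?hX_ge0// ler_nat.
have qb i c : 0 <= c <= 1 -> `|(q i).[c]| <= l%:R * B.
  move=> c01; apply: horner_bound => // k; apply: le_trans (qB _ _) _.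
  by rewrite ler_piMr// exprn_ile1// ?h_ge0 ?h_le1.
apply: eq_jet (jetD jqr (@jet_small l (fun i c => F i c * G i c - (q i * r i).[c])
  (B * CG + l%:R * B * C) _ _)) => [i c _||i c c01].
- by rewrite addrC subrK.
- by rewrite addr_ge0 ?mulr_ge0.
- have -> : F i c * G i c - (q i * r i).[c] =
    (F i c - (q i).[c]) * G i c + (q i).[c] * (G i c - (r i).[c]).
    by rewrite hornerM; ring.
  rewrite (le_trans (ler_normD _ _))// !normrM mulrDl lerD//.
    by rewrite mulrAC ler_pM// ?Fq ?GB.
  by rewrite -[leRHS]mulrA ler_pM// ?qb ?Gr.
Qed.

(** The factor [h i] of the derivative is what raises the order by one. *)
Lemma jet_primitive l F D (B0 : R) : 0 <= B0 ->
  (forall i, `|F i 0| <= B0) ->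
  (forall i (c : R), is_derive c 1 (F i) (h i * D i c)) ->
  jet l D -> jet l.+1 F.
Proof.
move=> B00 F0 dF [B B_ge0 [q [sq qB Dq]]].
exists (B0 + B); first exact: addr_ge0.
exists (fun i => (F i 0)%:P + h i *: primp (q i)); split => [i|i [|k]|i c c01].
- rewrite (leq_trans (size_polyD _ _))// geq_max (leq_trans (size_polyC_leq1 _))//=.
  by rewrite (leq_trans (size_scale_leq _ _))// (leq_trans (size_primp _))// ltnS.
- rewrite coefD coefC coefZ coef_primp eqxx mulr0 addr0 expr0 mulr1.
  by rewrite (le_trans (F0 i))// lerDl.
- rewrite coefD coefC coefZ coef_primp/= add0r normrM (ger0_norm (h_ge0 i)).
  rewrite exprS mulrCA ler_wpM2l ?h_ge0// normrM normfV normr_nat.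
  rewrite ler_pdivrMr ?ltr0n// (le_trans (qB i k))//.
  rewrite -mulrA ler_pM ?hX_ge0// ?lerDr// ler_peMr ?hX_ge0// ler1n //.
- pose G (x : R) := F i x - ((F i 0)%:P + h i *: primp (q i)).[x].
  have dG (x : R) : is_derive x 1 G (h i * (D i x - (q i).[x])).
    have dq := is_derive_poly ((F i 0)%:P + h i *: primp (q i)) x.
    apply: (is_derive_eq (is_deriveB (dF i x) dq)).
    by rewrite derivD derivC add0r derivZ primpK hornerZ mulrBr.
  have G0 : G 0 = 0 by rewrite /G !hornerE primp0 mulr0 addr0 subrr.
  have /andP[c0 c1] := c01.
  rewrite -[X in `|X|]/(G c) -[G c]subr0 -G0.
  apply: (@le_trans _ _ (h i * (B * h i ^+ l) * (c - 0))).
    apply: mean_value_bound c0 (fun x _ => dG x) _ _ => [|x /andP[x0 xc]].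
      by apply: derivable_within_continuous => x _; case: (dG x).
    rewrite normrM (ger0_norm (h_ge0 i)) ler_wpM2l ?h_ge0// Dq//.
    by rewrite x0 (le_trans xc).
  rewrite subr0 mulrCA -exprS; apply: (@le_trans _ _ (B * h i ^+ l.+1)).
    by rewrite ler_piMr// mulr_ge0// hX_ge0.
  by rewrite ler_wpM2r ?hX_ge0// lerDr.
Qed.

Section Composition.
Variables (m : nat) (S : I -> 'rV[{poly R}]_m) (M : R).
Hypothesis SM : forall i c, 0 <= c <= 1 -> `|peval (S i) c| <= M.

(** The nonconstant coefficients of [S i] are those of a jet of order [l], while
    the coefficients of degree above [l] are only known to be of size [h^l].
    The constant coefficient is the starting point of the step, which need not
    be small. *)
Definition jet_curve (l : nat) : Prop := forall a, exists n, exists2 B, 0 <= B &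
  forall i, (size (S i 0%R a) <= n)%N /\
    forall k, `|(S i 0%R a)`_k.+1| <= B * h i ^+ minn k.+1 l.

Lemma jet_curveS l : jet_curve l.+1 -> jet_curve l.
Proof.
move=> cS a; have [n [B B0 SB]] := cS a; exists n, B => // i.
have [sS {}cS] := SB i.
split => // k; rewrite (le_trans (cS k))// ler_wpM2l// hX_le//.
by rewrite leq_min geq_minl (leq_trans (geq_minr _ _)).
Qed.

(** Induction on [l]: the derivative of [g(S)] is [h] times a sum of products of
    partial derivatives of [g] along [S], jets by induction, and of
    [S' / h], a jet because of the bounds on the coefficients of [S]. *)
Lemma jet_comp l g : smooth l g -> jet_curve l ->
  jet l (fun i c => g (peval (S i) c)).
Proof.
elim: l g => [|l IHl] g sg cS.
  have [B B0 gB] := bounded_on_ball M (smooth_continuous sg).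
  by apply: (jet_small B0) => i c c01; rewrite expr0 mulr1; exact/gB/SM.
have [C C0 gC] := bounded_on_ball M (smooth_continuous sg).
pose T a i := (h i)^-1 *: (S i 0%R a)^`().
have jT a : jet l (fun i c => (T a i).[c]).
  have [n [B B0 SB]] := cS a.
  apply: (@jet_poly _ n _ (n%:R * B)) => [|i|i k]; first exact: mulr_ge0.
    have [sS _] := SB i.
    rewrite (leq_trans (size_scale_leq _ _))// (leq_trans _ sS)//.
    rewrite (leq_trans (size_poly _ _))//; exact: leq_pred.
  have [sS coS] := SB i.
  rewrite coefZ coef_deriv normrM normfV (ger0_norm (h_ge0 i)).
  have h0 : 0 < h i by case/andP: (h01 i).
  rewrite ler_pdivrMl// mulrCA -exprS -minnSS.
  have [kn|nk] := ltnP k n; last first.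
    rewrite nth_default ?mul0rn ?normr0 ?mulr_ge0 ?hX_ge0//.
    exact: leq_trans sS (leqW nk).
  rewrite -[X in `|X|]mulr_natl normrM normr_nat -[leRHS]mulrA ler_pM//.
  by rewrite ler_nat.
apply: (@jet_primitive l (fun i c => g (peval (S i) c))
  (fun i c => \sum_a partial a g (peval (S i) c) * (T a i).[c]) C C0).
- by move=> i; apply/gC/SM; rewrite lexx ler01.
- move=> i c.
  have sg1 : smooth 1 g by exact: smooth_le sg.
  have := chain_rule sg1 (fun a => is_derive_peval (S i) a c).
  move/is_derive_eq; apply; rewrite mulr_sumr; apply: eq_bigr => a _.
  rewrite hornerZ [RHS]mulrCA [h i * _]mulrA mulfV ?mul1r//.
  by case/andP: (h01 i) => /lt0r_neq0.
- apply: jet_sum => a; apply: jetM => //.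
  apply: IHl; first exact: smooth_partial.
  exact: jet_curveS.
Qed.

End Composition.
End Jets.

Section JetProjection.
Variables (R : realType) (P : nat -> {poly R}) (s : nat).
Hypothesis orthoP : orthonormal_legendre P.
Variables (I : Type) (h : I -> R).
Hypothesis h01 : forall i, 0 < h i <= 1.

(** The projection reproduces the polynomial part of the jet, whose degree is
    less than [s], and maps a remainder of size [h^l] to a polynomial of that
    size. *)
Lemma jet_projection l (F : I -> R -> R) : (l <= s)%N ->
  (forall i, continuous (F i)) -> jet h l F ->
  exists2 C, 0 <= C &
    (forall i k, `|(legendre_projection P s (F i))`_k| <= C * h i ^+ minn k l) /\
    (forall i c, 0 <= c <= 1 -> `|F i c - (legendre_projection P s (F i)).[c]| <= C * h i ^+ l).
Proof.
move=> ls cF [B B0 [q [sq qB Fq]]].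
have [D D0 PD] := legendre_bound s orthoP.
pose r i x := F i x - (q i).[x].
have cr i : continuous (r i).
  apply: continuous_add => // x.
  exact: (continuousN (@continuous_horner _ (q i) x)).
have rE i : legendre_projection P s (F i) = q i + legendre_projection P s (r i).
  rewrite {1}(legendre_expansion orthoP (leq_trans (sq i) ls)) -big_split/=.
  apply: eq_bigr => j _; rewrite -scalerDl -int01D; last 2 first.
  - by apply: mul_continuous_horner; exact: continuous_horner.
  - exact: mul_continuous_horner.
  by congr (int01 _ *: _); apply/funext => x; rewrite /r -mulrDr subrKC.
have ib i j : (j < s)%N -> `|int01 (fun x => (P j).[x] * r i x)| <= D * (B * h i ^+ l).
  move=> js; apply: int01_bound => [|x x01]; first exact: mul_continuous_horner.
  rewrite normrM; apply: ler_pM => //; last exact: Fq.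
  by case: (PD j js) => _; exact.
have hl0 i n : 0 <= h i ^+ n by exact: hX_ge0.
pose E := s%:R * (D * B * D).
have E0 : 0 <= E by rewrite !mulr_ge0.
have sE i (u : nat -> R) : (forall j, (j < s)%N -> `|u j| <= D) ->
    `|\sum_(j < s) int01 (fun x => (P j).[x] * r i x) * u j| <= E * h i ^+ l.
  move=> uD; rewrite (le_trans (ler_norm_sum _ _ _))//.
  apply: (@le_trans _ _ (\sum_(j < s) D * B * D * h i ^+ l)).
    apply: ler_sum => j _; rewrite normrM mulrAC -[D * B * _]mulrA.
    by apply: ler_pM => //; [exact: ib|exact: uD].
  by rewrite sumr_const card_ord /E -[leLHS]mulr_natl mulrA.
exists (B + E); first exact: addr_ge0.
split => [i k|i c c01].
- rewrite rE coefD mulrDl (le_trans (ler_normD _ _))// lerD//.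
    have [kl|lk] := ltnP k l; first exact: qB.
    by rewrite nth_default ?normr0 ?mulr_ge0// (leq_trans (sq i)).
  apply: (@le_trans _ _ (E * h i ^+ l)).
    rewrite /legendre_projection coef_sum (eq_bigr _ (fun j _ => coefZ _ _ _)).
    by apply: (sE i (fun j => (P j)`_k)) => j js; case: (PD j js).
  by rewrite ler_wpM2l// (hX_le h01)// geq_minr.
- rewrite rE hornerD opprD addrA mulrDl (le_trans (ler_normB _ _))// lerD//.
    exact: Fq.
  rewrite /legendre_projection horner_sum (eq_bigr _ (fun j _ => hornerZ _ _ _)).
  apply: (sE i (fun j => (P j).[c])) => j js.
  by case: (PD j js) => _; exact.
Qed.

(** The source of superconvergence: the defect is orthogonal to the polynomial
    part of [w], and the two remainders are both of size [h^s]. *)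
Lemma jet_projection_orthogonal (w F : I -> R -> R) :
  (forall i, continuous (w i)) -> (forall i, continuous (F i)) ->
  jet h s w -> jet h s F ->
  exists2 C, 0 <= C & forall i,
    `|int01 (fun x => w i x * (F i x - (legendre_projection P s (F i)).[x]))| <= C * h i ^+ (2 * s).
Proof.
move=> cw cF [B B0 [q [sq qB wq]]] jF.
have [C C0 [_ FC]] := jet_projection (leqnn s) cF jF.
exists (B * C); first exact: mulr_ge0.
move=> i.
have cG : continuous (fun x => F i x - (legendre_projection P s (F i)).[x]).
  apply: continuous_add => // x.
  exact: (continuousN (@continuous_horner _ (legendre_projection P s (F i)) x)).
have cr : continuous (fun x => w i x - (q i).[x]).
  apply: continuous_add => // x.
  exact: (continuousN (@continuous_horner _ (q i) x)).
have -> : (fun x => w i x * (F i x - (legendre_projection P s (F i)).[x])) = fun x =>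
   (q i).[x] * (F i x - (legendre_projection P s (F i)).[x]) +
   (w i x - (q i).[x]) * (F i x - (legendre_projection P s (F i)).[x]).
  by apply/funext => x; ring.
rewrite int01D; [|exact: mul_continuous_horner|exact: continuous_mul].
rewrite (projection_orthogonal orthoP)// add0r.
apply: int01_bound => [|x x01]; first exact: continuous_mul.
rewrite normrM mul2n -addnn exprD mulrACA.
by apply: ler_pM => //; [exact: wq|exact: FC].
Qed.

End JetProjection.

(** * Lie derivatives and the Taylor expansion of the flow *)

Section TaylorFlow.
Variables (R : realType) (m : nat) (f : 'rV[R]_m -> 'rV[R]_m).
Implicit Types (x : 'rV[R]_m) (g : 'rV[R]_m -> R).

Definition lie_deriv g : 'rV[R]_m -> R := fun x => \sum_a partial a g x * f x 0 a.

(** By the equation, the [k]-th time derivative of the [b]-th coordinate of a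
    solution [y] at time [t] is [lie k b (y t)]. *)
Definition lie (k : nat) (b : 'I_m) : 'rV[R]_m -> R :=
  iter k lie_deriv (fun x => x 0 b).

Definition taylor_flow (r : nat) (tau : R) (b : 'I_m) x : R :=
  \sum_(k < r.+1) tau ^+ k / k`!%:R * lie k b x.

Lemma taylor_flowS r tau b x : taylor_flow r.+1 tau b x =
  taylor_flow r tau b x + tau ^+ r.+1 / r.+1`!%:R * lie r.+1 b x.
Proof. by rewrite /taylor_flow big_ord_recr. Qed.

Lemma taylor_flow0 r b x : taylor_flow r 0 b x = x 0 b.
Proof.
rewrite /taylor_flow big_ord_recl/= expr0 fact0 divr1 mul1r big1 ?addr0// => k _.
by rewrite expr0n !mul0r.
Qed.

Variable K : nat.
Hypothesis sf : forall a, smooth K (fun x => f x 0 a).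

(** Each Lie derivative uses up one derivative of the coefficients of [f]; the
    coordinates themselves are smooth of every order, hence the successor. *)
Lemma lie_smooth k b : (k <= K)%N -> smooth (K - k).+1 (lie k b).
Proof.
elim: k => [|k IHk] kK; first exact: smooth_coord.
rewrite subnSK//; apply: smooth_sum => a; apply: smoothM.
  by apply: smooth_partial; apply: IHk; exact: ltnW.
by apply: smooth_le (sf a); exact: leq_subr.
Qed.

Lemma lie_smooth1 k b : (k <= K)%N -> smooth 1 (lie k b).
Proof. by move=> /(lie_smooth b); exact: smooth_le. Qed.

(** Along a solution, where [e] is 0, the terms of the derivative cancel in
    pairs and only the one of highest order remains.  The factor [h] is that of
    the time scale, and [e] is the deviation of the curve from a solution. *)
Lemma taylor_flow_derive r b (h c0 c : R) (z : R -> 'rV[R]_m) (e : 'I_m -> R) :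
  (r <= K)%N ->
  (forall a, is_derive c 1 (fun u => z u 0 a) (h * (f (z c) 0 a + e a))) ->
  is_derive c 1 (fun u => taylor_flow r (h * (c0 - u)) b (z u))
    (h * ((h * (c0 - c)) ^+ r / r`!%:R * lie r.+1 b (z c) +
          \sum_a (\sum_(k < r.+1) (h * (c0 - c)) ^+ k / k`!%:R * partial a (lie k b) (z c)) * e a)).
Proof.
move=> + dz.
have dlie k : (k <= K)%N -> is_derive c 1 (fun u => lie k b (z u))
    (h * (lie k.+1 b (z c) + \sum_a partial a (lie k b) (z c) * e a)).
  move=> kK; apply: is_derive_eq (chain_rule (lie_smooth1 b kK) dz) _.
  rewrite -big_split mulr_sumr; apply: eq_bigr => a _ /=; ring.
elim: r => [_|r IHr rK].
  have := dlie 0%N (leq0n _).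
  have -> : (fun u => taylor_flow 0 (h * (c0 - u)) b (z u)) = fun u => lie 0 b (z u).
    apply/funext => u; rewrite /taylor_flow big_ord1 expr0 fact0 divr1 mul1r//.
  move/is_derive_eq; apply; rewrite expr0 fact0 divr1 mul1r; congr (_ * (_ + _)).
  by apply: eq_bigr => a _; rewrite big_ord1 expr0 fact0 divr1 mul1r.
have -> : (fun u => taylor_flow r.+1 (h * (c0 - u)) b (z u)) = fun u =>
   taylor_flow r (h * (c0 - u)) b (z u) +
   (r.+1`!%:R^-1 *: ((h *: (c0%:P - 'X)) ^+ r.+1)).[u] * lie r.+1 b (z u).
  apply/funext => u; rewrite taylor_flowS !hornerE; congr (_ + _ * _).
  by rewrite mulrC.
have dp := is_derive_poly (r.+1`!%:R^-1 *: ((h *: (c0%:P - 'X)) ^+ r.+1)) c.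
apply: (is_derive_eq (is_deriveD (IHr (ltnW rK)) (is_deriveM dp (dlie _ rK)))).
have -> : \sum_a (\sum_(k < r.+2) (h * (c0 - c)) ^+ k / k`!%:R * partial a (lie k b) (z c)) * e a
  = \sum_a (\sum_(k < r.+1) (h * (c0 - c)) ^+ k / k`!%:R * partial a (lie k b) (z c)) * e a
    + (h * (c0 - c)) ^+ r.+1 / r.+1`!%:R * \sum_a partial a (lie r.+1 b) (z c) * e a.
  rewrite mulr_sumr -big_split; apply: eq_bigr => a _.
  by rewrite big_ord_recr/=; ring.
rewrite derivZ deriv_exp derivZ derivB derivC derivX sub0r/=.
have n1 : (r.+1%:R : R) != 0 by rewrite pnatr_eq0.
have n2 : (r`!%:R : R) != 0 by rewrite pnatr_eq0 -lt0n fact_gt0.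
have dE : (h *: -1 * (h *: (c0%:P - 'X)) ^+ r *+ r.+1).[c] =
    - h * (h * (c0 - c)) ^+ r * r.+1%:R.
  by rewrite hornerMn -[LHS]mulr_natr !hornerE; ring.
rewrite factS natrM !hornerE /= dE exprS.
rewrite [X in _ + X + _ = _]/GRing.scale [X in _ + X = _]/GRing.scale /=.
move: (r.+1%:R : R) (r`!%:R : R) n1 n2 => u v u0 v0.
by field; rewrite u0 v0.
Qed.
End TaylorFlow.

(** * Local error of one step *)

Lemma continuous_peval (R : realType) m (S : 'rV[{poly R}]_m) : continuous (peval S).
Proof.
move=> c; apply/differentiable_continuous/derivable1_diffP/derivable_mxP => i j.
by rewrite ord1; case: (is_derive_peval S j c).
Qed.

Lemma continuous_along_peval (R : realType) m (g : 'rV[R]_m -> R)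
  (S : 'rV[{poly R}]_m) : continuous g -> continuous (fun c => g (peval S c)).
Proof.
by move=> cg c; exact: (continuous_cvg _ (cg (peval S c)) (@continuous_peval R m S c)).
Qed.

Lemma norm_pow_fact (R : realType) (x : R) k : `|x ^+ k / k`!%:R| <= `|x| ^+ k.
Proof.
rewrite normrM normrX normfV normr_nat ler_pdivrMr ?ltr0n ?fact_gt0//.
by rewrite ler_peMr ?exprn_ge0// ler1n fact_gt0.
Qed.

(** One step in the rescaled variable [c] of [0,1], that is for
    [S(c) = sigma(c * h)]. *)
Definition spectral_step (R : realType) (m s : nat) (f : 'rV[R]_m -> 'rV[R]_m)
    (P : nat -> {poly R}) (h : R) (v : 'rV[R]_m) (S : 'rV[{poly R}]_m) : Prop :=
  peval S 0 = v /\ forall a,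
    (S 0 a)^`() = h *: legendre_projection P s (fun c => f (peval S c) 0 a).

Section LocalError.
Variables (R : realType) (m s : nat) (f : 'rV[R]_m -> 'rV[R]_m).
Variable P : nat -> {poly R}.
Hypothesis orthoP : orthonormal_legendre P.
Hypothesis hs : (0 < s)%N.
Hypothesis sf : forall a, smooth (3 * s) (fun x => f x 0 a).

Variables (I : Type) (h : I -> R) (S : I -> 'rV[{poly R}]_m) (M : R).
Hypothesis h01 : forall i, 0 < h i <= 1.
Hypothesis SM : forall i c, 0 <= c <= 1 -> `|peval (S i) c| <= M.

Let F a i c := f (peval (S i) c) 0 a.

Hypothesis stepE : forall i a, (S i 0 a)^`() = h i *: legendre_projection P s (F a i).

Let cF a i : continuous (F a i).
Proof.
by apply: (@continuous_along_peval R m (fun x => f x 0 a)); exact: smooth_continuous (sf a).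
Qed.

Lemma step_coef i a k : (S i 0%R a)`_k.+1 *+ k.+1 = h i * (legendre_projection P s (F a i))`_k.
Proof. by rewrite -coef_deriv stepE coefZ. Qed.

(** The bootstrap: [S'] is [h] times the projection of [f(S)]. *)
Lemma jet_curve_next l : (l <= s)%N -> (forall a, jet h l (F a)) ->
  jet_curve h S l.+1.
Proof.
move=> ls jF a; have [C C0 [pC _]] := jet_projection orthoP h01 ls (@cF a) (jF a).
exists s.+1, C => // i; split => [|k]; first exact: (size_step orthoP (stepE i a)).
apply: (@le_trans _ _ `|(S i 0%R a)`_k.+1 *+ k.+1|).
  by rewrite normrMn -[leRHS]mulr_natl ler_peMl// ler1n.
rewrite step_coef normrM (ger0_norm (h_ge0 h01 i)) minnSS exprS mulrCA.
by rewrite ler_wpM2l// (h_ge0 h01).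
Qed.

(** Order 0 is the boundedness of [f] on a ball; each further order comes from
    [jet_curve_next] followed by composition with [f]. *)
Lemma jet_field l : (l <= s)%N -> forall a, jet h l (F a).
Proof.
elim: l => [|l IHl] ls a.
  have [B B0 gB] := bounded_on_ball M (smooth_continuous (sf a)).
  by apply: (jet_small h01 B0) => i c c01; rewrite expr0 mulr1; exact/gB/SM.
apply: (@jet_comp _ _ _ h01 _ _ _ SM l.+1 (fun x => f x 0 a)).
  by apply: smooth_le (sf a); rewrite (leq_trans ls)// leq_pmull.
by apply: jet_curve_next => [|a']; [exact: ltnW|exact/IHl/ltnW].
Qed.

Lemma jet_smooth g : smooth s g -> jet h s (fun i c => g (peval (S i) c)).
Proof.
move=> sg; apply: (jet_comp h01 SM) => //.
by apply: jet_curveS => //; apply: jet_curve_next => //; exact: jet_field.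
Qed.

Let e a i c := (legendre_projection P s (F a i)).[c] - F a i c.

Let w b a i c0 c := \sum_(k < (2 * s).+1)
  (h i * (c0 - c)) ^+ k / k`!%:R * partial a (lie f k b) (peval (S i) c).

Let le23 : (2 * s <= 3 * s)%N. Proof. by rewrite leq_mul2r orbT. Qed.
Let lt23 : (2 * s < 3 * s)%N. Proof. by rewrite ltn_mul2r hs. Qed.

Let sm_lie b k : (k <= 2 * s)%N -> smooth s.+1 (lie f k b).
Proof.
move=> k2; apply: smooth_le (lie_smooth sf b (leq_trans k2 le23)).
by rewrite ltnS leq_subRL ?(leq_trans k2)// addnC mulSn leq_add2l.
Qed.

Let small_tau i c0 c : 0 <= c0 <= 1 -> 0 <= c <= c0 -> `|h i * (c0 - c)| <= h i.
Proof.
move=> /andP[c00 c01] /andP[c0' cc]; rewrite normrM (ger0_norm (h_ge0 h01 i)).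
rewrite ler_piMr ?(h_ge0 h01)// ger0_norm ?subr_ge0//; lra.
Qed.

Let dW b i c0 (c : R) : is_derive c 1
   (fun u => taylor_flow f (2 * s) (h i * (c0 - u)) b (peval (S i) u))
   (h i * ((h i * (c0 - c)) ^+ (2 * s) / (2 * s)`!%:R * lie f (2 * s).+1 b (peval (S i) c)
      + \sum_a w b a i c0 c * e a i c)).
Proof.
apply: (taylor_flow_derive sf) => // a.
apply: is_derive_eq (is_derive_peval (S i) a c) _.
by rewrite stepE hornerZ /e addrC subrK.
Qed.

Let defect_small a : exists2 C, 0 <= C &
  forall i c, 0 <= c <= 1 -> `|e a i c| <= C * h i ^+ s.
Proof.
have [C C0 [_ eC]] := jet_projection orthoP h01 (leqnn s) (@cF a) (jet_field (leqnn s) a).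
by exists C => // i c c01; rewrite /e distrC; exact: eC.
Qed.

Let bounded_lie b : exists2 C, 0 <= C &
  forall i c0 c, 0 <= c0 <= 1 -> 0 <= c <= c0 ->
  `|(h i * (c0 - c)) ^+ (2 * s) / (2 * s)`!%:R * lie f (2 * s).+1 b (peval (S i) c)|
    <= C * h i ^+ (2 * s).
Proof.
have [C C0 lC] := bounded_on_ball M (smooth_continuous (lie_smooth sf b lt23)).
exists C => // i c0 c c001 cc0; rewrite normrM mulrC; apply: ler_pM => //.
  apply/lC/SM; case/andP: c001 => ? ?; case/andP: cc0 => -> ?; lra.
rewrite (le_trans (norm_pow_fact _ _))// lerXn2r ?nnegrE ?(h_ge0 h01)//.
exact: small_tau.
Qed.

Let bounded_w b a : exists2 C, 0 <= C &
  forall i c0 c, 0 <= c0 <= 1 -> 0 <= c <= c0 -> `|w b a i c0 c| <= C.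
Proof.
have /choice[C CP] : forall k : 'I_(2 * s).+1, exists C, 0 <= C /\
    forall x, `|x| <= M -> `|partial a (lie f k b) x| <= C.
  move=> k; have sk : (k <= 2 * s)%N by rewrite -ltnS.
  have [C C0 HC] := bounded_on_ball M (smooth_continuous (smooth_partial a (sm_lie b sk))).
  by exists C.
exists (\sum_k C k) => [|i c0 c c001 cc0]; first by apply: sumr_ge0 => k _; case: (CP k).
rewrite (le_trans (ler_norm_sum _ _ _))//; apply: ler_sum => k _.
rewrite normrM -[leRHS]mul1r; apply: ler_pM => //.
  rewrite (le_trans (norm_pow_fact _ _))// exprn_ile1//.
  exact: le_trans (small_tau _ c001 cc0) (h_le1 h01 i).
case: (CP k) => _; apply; apply: SM.
by case/andP: c001 => ? ?; case/andP: cc0 => -> ?; lra.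
Qed.

(** The derivative of [c |-> U (h (c0 - c)) (S c)] is at most of size [h * h^s],
    the size of the defect. *)
Lemma local_error_uniform b : exists2 C, 0 <= C & forall i c0, 0 <= c0 <= 1 ->
  `|peval (S i) c0 0 b - taylor_flow f (2 * s) (h i * c0) b (peval (S i) 0)|
    <= C * h i ^+ s.+1.
Proof.
have [CA CA0 HA] := bounded_lie b.
have /choice[Ce CeP] : forall a, exists C, 0 <= C /\
    forall i c, 0 <= c <= 1 -> `|e a i c| <= C * h i ^+ s.
  by move=> a; have [C] := defect_small a; exists C.
have /choice[Cw CwP] : forall a, exists C, 0 <= C /\
    forall i c0 c, 0 <= c0 <= 1 -> 0 <= c <= c0 -> `|w b a i c0 c| <= C.
  by move=> a; have [C] := bounded_w b a; exists C.
pose C := CA + \sum_a Cw a * Ce a.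
have C0 : 0 <= C.
  rewrite addr_ge0// sumr_ge0// => a _; rewrite mulr_ge0//.
    by case: (CwP a).
  by case: (CeP a).
exists C => // i c0 c001; have /andP[c00 c01] := c001.
pose W (u : R) := taylor_flow f (2 * s) (h i * (c0 - u)) b (peval (S i) u).
have -> : peval (S i) c0 0 b = W c0 by rewrite /W subrr mulr0 taylor_flow0.
have -> : taylor_flow f (2 * s) (h i * c0) b (peval (S i) 0) = W 0.
  by rewrite /W subr0.
apply: (@le_trans _ _ (h i * (C * h i ^+ s) * (c0 - 0))); last first.
  rewrite subr0 mulrCA -exprS ler_piMr// mulr_ge0//.
  exact: hX_ge0.
apply: mean_value_bound c00 (fun c _ => dW b i c0 c) _ _.
  by apply: derivable_within_continuous => x _; case: (dW b i c0 x).
move=> c cc0; have c1 : 0 <= c <= 1.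
  by case/andP: cc0 => -> ?; lra.
rewrite normrM (ger0_norm (h_ge0 h01 i)) ler_wpM2l ?(h_ge0 h01)//.
rewrite mulrDl (le_trans (ler_normD _ _))// lerD//.
  rewrite (le_trans (HA _ _ _ c001 cc0))// ler_wpM2l// (hX_le h01)//.
  by rewrite leq_pmull.
rewrite (le_trans (ler_norm_sum _ _ _))// mulr_suml; apply: ler_sum => a _.
rewrite normrM -mulrA; apply: ler_pM => //.
  by case: (CwP a) => _; apply.
by case: (CeP a) => _; apply.
Qed.

Let jet_w b a : jet h s (fun i c => w b a i 1 c).
Proof.
have jtau : jet h s (fun i c => h i * (1 - c)).
  apply: (@eq_jet _ _ _ s (fun i c => (h i *: (1%:P - 'X)).[c])) => [i c _|].
    by rewrite !hornerE.
  apply: (@jet_poly _ _ _ h01 s 2 _ 1) => // [i|i k].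
    rewrite (leq_trans (size_scale_leq _ _))// (leq_trans (size_polyD _ _))//.
    by rewrite size_polyN size_polyX geq_max (leq_trans (size_polyC_leq1 _)).
  have hm (n : nat) : (n <= 1)%N -> h i <= h i ^+ n.
    by move=> n1; rewrite -[X in X <= _]expr1 (hX_le h01).
  rewrite mul1r coefZ coefB coefC coefX.
  case: k => [|[|k]]; rewrite /= ?subr0 ?sub0r ?oppr0 ?mulr0 ?mulr1 ?mulrN1 ?normrN.
  - by rewrite (ger0_norm (h_ge0 h01 i)) hm// geq_min.
  - by rewrite (ger0_norm (h_ge0 h01 i)) hm// geq_min.
  - by rewrite normr0 (hX_ge0 h01).
have jcst (x : R) : jet h s (fun _ _ => x).
  apply: (@eq_jet _ _ _ s (fun i c => (x%:P).[c])) => [i c _|]; first by rewrite hornerC.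
  apply: (@jet_poly _ _ _ h01 s 1 _ `|x|) => // [i|i k]; first exact: size_polyC_leq1.
  rewrite coefC; case: k => [|k]; first by rewrite min0n expr0 mulr1.
  by rewrite normr0 mulr_ge0// (hX_ge0 h01).
have jX k : jet h s (fun i c => (h i * (1 - c)) ^+ k).
  elim: k => [|k IHk]; first exact: jcst.
  by apply: eq_jet (jetM h01 jtau IHk) => i c _; rewrite exprS.
apply: jet_sum => // k; apply: jetM => //; first by apply: jetM.
by apply: jet_smooth; apply: smooth_partial; apply: sm_lie; rewrite -ltnS.
Qed.

(** Over the whole step the defect can be integrated, instead of bounded,
    against the gradient of the Taylor map, which is a jet of order [s]. *)
Lemma local_error_endpoint b : exists2 C, 0 <= C & forall i,
  `|peval (S i) 1 0 b - taylor_flow f (2 * s) (h i) b (peval (S i) 0)|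
    <= C * h i ^+ (2 * s).+1.
Proof.
have [CA CA0 HA] := bounded_lie b.
have ctau i k : continuous (fun c : R => (h i * (1 - c)) ^+ k / k`!%:R).
  rewrite (_ : (fun _ => _) = horner (k`!%:R^-1 *: (h i *: (1%:P - 'X)) ^+ k)).
    exact: continuous_horner.
  by apply/funext => u; rewrite !hornerE mulrC.
have cw a i : continuous (fun c => w b a i 1 c).
  apply: continuous_sum => k; apply: continuous_mul; first exact: ctau.
  apply: continuous_along_peval; apply: smooth_continuous (smooth_partial a _).
  by apply: sm_lie; rewrite -ltnS.
have /choice[Ce CeP] : forall a, exists C, 0 <= C /\
    forall i, `|int01 (fun c => w b a i 1 c * e a i c)| <= C * h i ^+ (2 * s).
  move=> a; have [C C0 HC] := jet_projection_orthogonal orthoP h01 (cw a) (@cF a)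
    (jet_w b a) (jet_field (leqnn s) a).
  exists C; split => // i; have := HC i.
  have -> : (fun x => w b a i 1 x * (F a i x - (legendre_projection P s (F a i)).[x])) =
     fun x => (-1) * (w b a i 1 x * e a i x).
    by apply/funext => x; rewrite /e; ring.
  rewrite int01Z ?mulN1r ?normrN//; apply: continuous_mul => //.
  apply: continuous_add; first exact: continuous_horner.
  by move=> x; exact: (continuousN (@cF a i x)).
pose C := CA + \sum_a Ce a.
have C0 : 0 <= C.
  by rewrite addr_ge0// sumr_ge0// => a _; case: (CeP a).
exists C => // i.
pose W (u : R) := taylor_flow f (2 * s) (h i * (1 - u)) b (peval (S i) u).
have -> : peval (S i) 1 0 b = W 1 by rewrite /W subrr mulr0 taylor_flow0.
have -> : taylor_flow f (2 * s) (h i) b (peval (S i) 0) = W 0.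
  by rewrite /W subr0 mulr1.
have cA : continuous (fun c : R => (h i * (1 - c)) ^+ (2 * s) / (2 * s)`!%:R *
    lie f (2 * s).+1 b (peval (S i) c)).
  apply: continuous_mul => //.
  apply: continuous_along_peval; exact: smooth_continuous (lie_smooth sf b lt23).
have ce a : continuous (fun c => e a i c).
  apply: continuous_add; first exact: continuous_horner.
  by move=> x; exact: (continuousN (@cF a i x)).
have cwe : continuous (fun c => \sum_a w b a i 1 c * e a i c).
  by apply: continuous_sum => a; apply: continuous_mul.
rewrite -(int01_derive (dW b i 1)); last first.
  by apply: continuous_mul; [exact: cst_continuous|exact: continuous_add].
rewrite int01Z; last exact: continuous_add.
rewrite normrM (ger0_norm (h_ge0 h01 i)) exprS mulrCA ler_wpM2l ?(h_ge0 h01)//.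
rewrite int01D// mulrDl (le_trans (ler_normD _ _))// lerD//.
  by apply: int01_bound => // x x01; apply: HA; rewrite ?ler01 ?lexx.
rewrite int01_sum => [|a]; last exact: continuous_mul.
rewrite (le_trans (ler_norm_sum _ _ _))// mulr_suml; apply: ler_sum => a _.
by case: (CeP a).
Qed.

End LocalError.

(** * The exact solution and the comparison of norms *)

Section Exact.
Variables (R : realType) (m : nat) (f : 'rV[R]_m -> 'rV[R]_m).
Variables (t0 T : R) (y0 : 'rV[R]_m) (y : R -> 'rV[R]_m).
Hypothesis solP : is_solution f t0 T y0 y.

(** First order expansion, one-sided at the end points of the interval, from
    which continuity and the interior derivative both follow. *)
Lemma solution_expansion t (e : R) : t0 <= t <= T -> 0 < e ->
  exists2 d : R, 0 < d & forall u, t0 <= u <= T -> `|u - t| < d ->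
    `|y u - y t - (u - t) *: f (y t)| <= e * `|u - t|.
Proof.
move=> tI e0; have [_ /(_ t)] := solP.
rewrite in_itv/= => /(_ tI)/cvgrPdist_le/(_ e e0).
move=> [d /= d0 H]; exists d => // u uI ut.
have [->|unt] := eqVneq u t; first by rewrite !subrr scale0r subrr !normr0 mulr0.
have ut0 : u - t != 0 by rewrite subr_eq0.
have := H u; rewrite /ball_/= distrC => /(_ ut unt).
rewrite in_itv/= => /(_ uI) {}H.
have -> : y u - y t - (u - t) *: f (y t) =
    (u - t) *: ((u - t)^-1 *: (y u - y t) - f (y t)).
  by rewrite scalerBr scalerA mulfV// scale1r.
by rewrite normrZ mulrC distrC ler_wpM2r.
Qed.

Lemma solution_continuous : {within `[t0, T], continuous y}.
Proof.
apply/subspace_continuousP => t /=; rewrite in_itv/= => tI.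
apply/cvgrPdist_le => e e0.
have [d d0 H] := solution_expansion tI ltr01.
pose L := 1 + `|f (y t)|.
have L0 : 0 < L by rewrite ltr_wpDr.
near=> u; have uI : t0 <= u <= T.
  by have : u \in `[t0, T] by near: u; exact: withinT.
have ut : `|u - t| < Num.min d (e / L).
  near: u; apply: cvg_within; apply/nbhs_ballP => /=.
  exists (Num.min d (e / L)) => /=; first by rewrite lt_min d0 divr_gt0.
  by move=> u; rewrite /ball/= distrC.
move: ut; rewrite lt_min => /andP[ud ue].
rewrite distrC -[y u - y t](subrK ((u - t) *: f (y t))).
rewrite (le_trans (ler_normD _ _))//.
apply: (@le_trans _ _ (L * `|u - t|)).
  by rewrite /L mulrDl lerD ?H// normrZ mulrC.
by rewrite mulrC -ler_pdivlMr// ltW.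
Unshelve. all: by end_near. Qed.

Lemma solution_derive (t : R) a : t0 < t < T ->
  is_derive t 1 (fun u => y u 0 a) (f (y t) 0 a).
Proof.
move=> /andP[tl tr].
have E : (h^-1 *: (((fun u => y u 0 a) \o shift t) (h *: 1) - y t 0 a))
    @[h --> (0:R)^'] --> f (y t) 0 a.
  apply/cvgrPdist_le => e e0.
  have tI : t0 <= t <= T by rewrite !ltW.
  have [d d0 H] := solution_expansion tI e0.
  near=> h.
  have h0 : h != 0 by near: h; exact: nbhs_dnbhs_neq.
  have : `|h| < Num.min d (Num.min (t - t0) (T - t)).
    by near: h; apply: dnbhs0_lt; rewrite !lt_min d0 !subr_gt0 tl.
  rewrite !lt_min => /and3P[hd h1 h2].
  have := H (h + t); rewrite addrK => /(_ _ hd).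
  move: h1 h2; rewrite !ltr_norml => /andP[h1 h1'] /andP[h2 h2'].
  have -> : t0 <= h + t <= T by apply/andP; split; lra.
  move/(_ isT)/(le_trans (rV_coord_le _ a)); rewrite !mxE.
  rewrite /= [h%:A]mulr1 -[_ *: _]/(_ * _) distrC => H'.
  have hn : 0 < `|h| by rewrite normr_gt0.
  rewrite -(ler_pM2r hn) -normrM mulrBl mulrAC mulVf// mul1r [_ * h]mulrC.
  exact: H'.
by apply: DeriveDef; [apply/cvg_ex; eexists; exact: E|exact/cvg_lim].
Unshelve. all: by end_near. Qed.

Lemma solution_bounded : t0 < T ->
  exists2 M, 0 <= M & forall t, t0 <= t <= T -> `|y t| <= M.
Proof.
move=> t0T.
have : bounded_set (y @` `[t0, T]).
  apply: compact_bounded; apply: continuous_compact => //.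
    exact: solution_continuous.
  exact: segment_compact.
case=> M0 [M0r HM]; exists (`|M0| + 1); first by rewrite addr_ge0.
move=> t tI; apply: (HM (`|M0| + 1)).
  by rewrite (le_lt_trans (ler_norm _))// ltrDl.
by exists t => //=; rewrite in_itv.
Qed.

Variables (K r : nat).
Hypothesis sf : forall a, smooth K (fun x => f x 0 a).
Hypothesis rK : (r < K)%N.

Lemma exact_taylor_error M b : (forall t, t0 <= t <= T -> `|y t| <= M) ->
  exists2 C, 0 <= C & forall t tau, t0 <= t -> 0 <= tau <= 1 -> t + tau <= T ->
    `|y (t + tau) 0 b - taylor_flow f r tau b (y t)| <= C * tau ^+ r.+1.
Proof.
move=> yM.
have [C C0 HC] := bounded_on_ball M (smooth_continuous (lie_smooth sf b rK)).
exists C => // t tau t0t /andP[tau0 tau1] tT.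
pose W (u : R) := taylor_flow f r (1 * (t + tau - u)) b (y u).
have dW (u : R) : t < u < t + tau -> is_derive u 1 W
   ((t + tau - u) ^+ r / r`!%:R * lie f r.+1 b (y u)).
  move=> /andP[tu ut].
  have dy a : is_derive u 1 (fun v => y v 0 a) (1 * (f (y u) 0 a + (fun=> 0) a)).
    by rewrite mul1r addr0; apply: solution_derive; apply/andP; split; lra.
  apply: is_derive_eq (taylor_flow_derive sf b (t + tau) (ltnW rK) dy) _.
  by rewrite !mul1r big1 ?addr0// => a _; rewrite mulr0.
have -> : y (t + tau) 0 b = W (t + tau) by rewrite /W subrr mulr0 taylor_flow0.
have -> : taylor_flow f r tau b (y t) = W t by rewrite /W mul1r addrAC subrr add0r.
have -> : C * tau ^+ r.+1 = (C * tau ^+ r) * (t + tau - t).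
  by rewrite [t + tau]addrC addrK -mulrA -exprSr.
have ttau : t <= t + tau by rewrite lerDl.
apply: (mean_value_bound ttau dW).
  have cy : {within `[t, t + tau], continuous y}.
    apply: continuous_subspaceW solution_continuous.
    by apply: subset_itv; rewrite bnd_simp.
  apply: continuous_sum => k; apply: continuous_mul.
    have cp : continuous (fun u : R => (1 * (t + tau - u)) ^+ k / k`!%:R).
      rewrite (_ : (fun _ => _) = horner (k`!%:R^-1 *: ((t + tau)%:P - 'X) ^+ k)).
        exact: continuous_horner.
      by apply/funext => u; rewrite !hornerE mulrC.
    exact: continuous_subspaceT.
  have kK : (k <= K)%N by rewrite -ltnS (leq_trans (ltn_ord k))// ltnW.
  have cl := smooth_continuous (lie_smooth sf b kK).
  move=> u; exact: (continuous_cvg _ (cl (y u)) (cy u)).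
move=> u /andP[tu ut]; rewrite normrM mulrC; apply: ler_pM => //.
  by apply/HC/yM; apply/andP; split; lra.
rewrite (le_trans (norm_pow_fact _ _))// lerXn2r ?nnegrE//.
by rewrite ger0_norm; lra.
Qed.

End Exact.

Section LipschitzFlow.
Variables (R : realType) (m K r : nat) (f : 'rV[R]_m -> 'rV[R]_m).
Hypothesis sf : forall a, smooth K (fun x => f x 0 a).
Hypothesis rK : (r <= K)%N.

Lemma taylor_flow_lipschitz M b : exists2 L, 0 <= L &
  forall x x' tau, `|x| <= M -> `|x'| <= M -> 0 <= tau <= 1 ->
  `|(taylor_flow f r tau b x' - x' 0 b) - (taylor_flow f r tau b x - x 0 b)|
    <= tau * L * `|x' - x|.
Proof.
have /choice[L LP] : forall k : 'I_r, exists L, 0 <= L /\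
    forall x x', `|x| <= M -> `|x'| <= M ->
      `|lie f k.+1 b x' - lie f k.+1 b x| <= L * `|x' - x|.
  move=> k; have [|L L0 HL] := @lipschitz_on_ball _ _ (lie f k.+1 b) M.
    by apply: (lie_smooth1 sf); exact: leq_trans rK.
  by exists L.
exists (\sum_k L k) => [|x x' tau xM x'M /andP[tau0 tau1]].
  by apply: sumr_ge0 => k _; case: (LP k).
have E z : taylor_flow f r tau b z - z 0 b =
    \sum_(k < r) tau ^+ k.+1 / k.+1`!%:R * lie f k.+1 b z.
  rewrite /taylor_flow big_ord_recl/= expr0 fact0 divr1 mul1r [X in X - _]addrC addrK.
  by apply: eq_bigr.
rewrite !E -sumrB (le_trans (ler_norm_sum _ _ _))// mulr_sumr mulr_suml.
apply: ler_sum => k _; rewrite -mulrBr normrM -mulrA; apply: ler_pM => //.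
  rewrite (le_trans (norm_pow_fact _ _))// ger0_norm// exprS ler_piMr//.
  by rewrite exprn_ile1.
by case: (LP k) => _; apply.
Qed.

End LipschitzFlow.

Section NormEquivalence.
Variables (R : realType) (m : nat) (nrm : 'rV[R]_m -> R).
Hypothesis nrmP : is_vnorm nrm.

Lemma vnorm0 : nrm 0 = 0.
Proof. by rewrite -(scale0r (0 : 'rV[R]_m)) (vnorm_scale nrmP) normr0 mul0r. Qed.

Lemma vnormN u : nrm (- u) = nrm u.
Proof. by rewrite -scaleN1r (vnorm_scale nrmP) normrN normr1 mul1r. Qed.

Lemma vnorm_ge0 u : 0 <= nrm u.
Proof.
have := vnorm_triangle nrmP u (- u); rewrite subrr vnorm0 vnormN; lra.
Qed.

Lemma vnorm_le_sup : exists2 C, 0 <= C & forall u, nrm u <= C * `|u|.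
Proof.
exists (\sum_j nrm (delta_mx 0 j)) => [|u].
  by apply: sumr_ge0 => j _; exact: vnorm_ge0.
rewrite {1}[u]row_sum_delta mulr_suml.
elim/big_ind2 : _ => [|x1 x2 y1 y2 H1 H2|j _]; first by rewrite vnorm0.
  by rewrite (le_trans (vnorm_triangle nrmP _ _))// lerD.
by rewrite (vnorm_scale nrmP) mulrC ler_wpM2l ?vnorm_ge0// rV_coord_le.
Qed.

Lemma vnorm_continuous : continuous nrm.
Proof.
have [C C0 HC] := vnorm_le_sup.
have C1 : 0 < C + 1 by rewrite ltr_wpDl.
move=> u; apply/(@cvgrPdist_le _ _ _ (nbhs u) _ nrm (nrm u)) => e e0; apply/nbhs_ballP.
exists (e / (C + 1)) => /=; first exact: divr_gt0.
move=> v; rewrite -ball_normE /= => /ltW uv.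
have H (a b : 'rV[R]_m) : nrm a - nrm b <= C * `|a - b|.
  by rewrite lerBlDr (le_trans _ (lerD (HC _) (lexx _)))// -{1}[a](subrK b) (vnorm_triangle nrmP).
apply: (@le_trans _ _ (C * `|u - v|)).
  by rewrite ler_norml H andbT lerNl opprB distrC H.
rewrite ler_pdivlMr// in uv; apply: le_trans uv.
by rewrite mulrC ler_wpM2l// lerDl.
Qed.

(** [nrm] attains a positive minimum on the unit sphere of the sup norm; the
    sphere is empty in dimension 0. *)
Lemma sup_le_vnorm : exists2 C, 0 <= C & forall u, `|u| <= C * nrm u.
Proof.
pose A := [set u : 'rV[R]_m | `|u| = 1].
have [A0|/set0P/negP/negPn/eqP A0] := pselect (A !=set0); last first.
  exists 0 => // u; rewrite mul0r; have [->|u0] := eqVneq u 0; first by rewrite normr0.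
  have : A (`|u|^-1 *: u).
    by rewrite /A/= normrZ normfV normr_id mulVf// normr_eq0.
  by rewrite A0.
have cA : compact A.
  apply: bounded_closed_compact.
    exists 1; split => // M M1 u /= ->; exact: ltW.
  rewrite (_ : A = (fun u => `|u|) @^-1` [set 1])//.
  apply: closed_comp => [u _|]; first exact: norm_continuous.
  exact: closed_eq.
have [c] := EVT_min_rV A0 cA (continuous_subspaceT vnorm_continuous).
rewrite inE /A/= => c1 cmin.
have c0 : 0 < nrm c.
  rewrite lt_neqAle vnorm_ge0 andbT eq_sym; apply/eqP => /(vnorm_eq0 nrmP) c0.
  by move: c1; rewrite c0 normr0 => /eqP; rewrite eq_sym oner_eq0.
exists (nrm c)^-1 => [|u]; first by rewrite invr_ge0 ltW.
have [->|u0] := eqVneq u 0; first by rewrite vnorm0 normr0 mulr0.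
have un : 0 < `|u| by rewrite normr_gt0.
have := cmin (`|u|^-1 *: u).
rewrite inE /A/= normrZ normfV normr_id mulVf ?gt_eqF// => /(_ erefl).
rewrite (vnorm_scale nrmP) normfV normr_id => H.
by rewrite ler_pdivlMl// -ler_pdivlMr// mulrC.
Qed.

End NormEquivalence.

(** * Solvability of one step *)

(** Joins the norm and the completeness of matrices, for the fixed point theorem. *)
HB.instance Definition _ (R : realType) (n m : nat) :=
  Complete.copy 'M[R]_(n, m) 'M[R]_(n, m).

Section Solvability.
Variables (R : realType) (m s : nat) (f : 'rV[R]_m -> 'rV[R]_m).
Variable P : nat -> {poly R}.
Hypothesis orthoP : orthonormal_legendre P.
Hypothesis sf : forall a, smooth 1 (fun x => f x 0 a).
Implicit Types (v : 'rV[R]_m) (S : 'rV[{poly R}]_m) (gam : 'M[R]_(s, m)).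

(** The unknown of the fixed point problem is the matrix of the Legendre
    coefficients of the vector field along the step. *)
Definition step_coefs S : 'M[R]_(s, m) :=
  \matrix_(j, a) int01 (fun x => (P j).[x] * f (peval S x) 0 a).

Definition step_curve (h : R) v gam : 'rV[{poly R}]_m :=
  \row_a ((v 0 a)%:P + h *: \sum_(j < s) gam j a *: primp (P j)).

Let cf a S : continuous (fun x => f (peval S x) 0 a).
Proof.
by apply: (@continuous_along_peval R m (fun x => f x 0 a)); exact: smooth_continuous (sf a).
Qed.

Lemma step_curve0 h v gam : peval (step_curve h v gam) 0 = v.
Proof.
apply/rowP => a; rewrite !mxE !hornerE horner_sum big1 ?mulr0 ?addr0// => j _.
by rewrite hornerZ primp0 mulr0.
Qed.

(** Integrating the equation for [S'] from the starting point turns a step into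
    a fixed point equation for the coefficients. *)
Lemma spectral_stepP h v S :
  spectral_step s f P h v S <-> S = step_curve h v (step_coefs S).
Proof.
have D a gam : (step_curve h v gam 0 a)^`() = h *: \sum_(j < s) gam j a *: P j.
  rewrite mxE derivD derivC add0r derivZ raddf_sum; congr (_ *: _).
  by apply: eq_bigr => j _; rewrite /= derivZ primpK.
have E a : \sum_(j < s) step_coefs S j a *: P j =
    legendre_projection P s (fun c => f (peval S c) 0 a).
  by apply: eq_bigr => j _; rewrite mxE.
split => [[S0 dS]|ES]; last first.
  split; first by rewrite ES step_curve0.
  by move=> a; rewrite {1}ES D E.
apply/rowP => a; apply: poly_deriv_eq; first by rewrite dS D E.
have /rowP/(_ a) := S0; have /rowP/(_ a) := step_curve0 h v (step_coefs S).
by rewrite [LHS]mxE [X in _ -> X = _ -> _]mxE => -> ->.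
Qed.

Lemma step_curve_dist : exists2 Q, 0 <= Q & forall h v gam gam' c,
  0 <= h -> 0 <= c <= 1 ->
  `|peval (step_curve h v gam) c - peval (step_curve h v gam') c|
    <= h * Q * `|gam - gam'|.
Proof.
have [D D0 PD] := legendre_bound s orthoP.
have [Q EQ] : exists Q, Q = s%:R * D by eexists.
have Q0 : 0 <= Q by rewrite EQ mulr_ge0.
exists Q => // h v gam gam' c h0 c01.
have [c0 c1] := andP c01.
have prD j : (j < s)%N -> `|(primp (P j)).[c]| <= D.
  move=> js; rewrite -[X in `|X|]subr0 -(primp0 (P j)).
  apply: (@le_trans _ _ (D * (c - 0))); last by rewrite subr0 ler_piMr.
  apply: (mean_value_bound c0 (fun x _ => is_derive_poly (primp (P j)) x)).
    exact/continuous_subspaceT/continuous_horner.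
  move=> x /andP[x0 xc]; rewrite primpK; case: (PD j js) => _; apply.
  by rewrite x0 (le_trans xc).
apply: rV_norm_le => [|a]; first by rewrite !mulr_ge0.
rewrite !mxE !hornerE !horner_sum opprD addrACA subrr add0r -mulrBr -sumrB.
rewrite normrM (ger0_norm h0) -[leRHS]mulrA ler_wpM2l// (le_trans (ler_norm_sum _ _ _))//.
apply: (@le_trans _ _ (\sum_(j < s) D * `|gam - gam'|)).
  apply: ler_sum => j _; rewrite !hornerZ -mulrBl normrM mulrC.
  apply: ler_pM => //; first exact: prD.
  by have := mx_entry_le (gam - gam') j a; rewrite !mxE.
by rewrite sumr_const card_ord -[leLHS]mulr_natl mulrA EQ.
Qed.

Lemma step_coefs_bound M : exists2 B, 0 <= B & forall S,
  (forall c, 0 <= c <= 1 -> `|peval S c| <= M) -> `|step_coefs S| <= B.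
Proof.
have [D D0 PD] := legendre_bound s orthoP.
have /choice[B BP] : forall a, exists B, 0 <= B /\
    forall x, `|x| <= M -> `|f x 0 a| <= B.
  move=> a; have [B] := bounded_on_ball M (smooth_continuous (sf a)).
  by exists B.
have sB a : B a <= \sum_a B a.
  rewrite (bigD1 a)//= lerDl sumr_ge0// => b _; by case: (BP b).
have B0 : 0 <= \sum_a B a by apply: sumr_ge0 => a _; case: (BP a).
exists (D * \sum_a B a) => [|S SM]; first exact: mulr_ge0.
apply: mx_norm_le => [|j a]; first exact: mulr_ge0.
rewrite mxE; apply: int01_bound => [|x x01]; first exact: mul_continuous_horner.
rewrite normrM; apply: ler_pM => //.
  by case: (PD j (ltn_ord j)) => _; exact.
by apply: le_trans (sB a); case: (BP a) => _; apply; exact: SM.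
Qed.

Lemma step_coefs_lipschitz M : exists2 L, 0 <= L & forall S S' e,
  (forall c, 0 <= c <= 1 -> `|peval S c| <= M) ->
  (forall c, 0 <= c <= 1 -> `|peval S' c| <= M) ->
  0 <= e -> (forall c, 0 <= c <= 1 -> `|peval S c - peval S' c| <= e) ->
  `|step_coefs S - step_coefs S'| <= L * e.
Proof.
have [D D0 PD] := legendre_bound s orthoP.
have /choice[L LP] : forall a, exists L, 0 <= L /\
    forall x x', `|x| <= M -> `|x'| <= M -> `|f x' 0 a - f x 0 a| <= L * `|x' - x|.
  by move=> a; have [L] := lipschitz_on_ball M (sf a); exists L.
have sL a : L a <= \sum_a L a.
  rewrite (bigD1 a)//= lerDl sumr_ge0// => b _; by case: (LP b).
have L0 : 0 <= \sum_a L a by apply: sumr_ge0 => a _; case: (LP a).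
exists (D * \sum_a L a) => [|S S' e SM SM' e0 SS']; first exact: mulr_ge0.
apply: mx_norm_le => [|j a]; first by rewrite !mulr_ge0.
rewrite !mxE -mulN1r -int01Z; last exact: mul_continuous_horner.
rewrite -int01D; [|exact: mul_continuous_horner|]; last first.
  by apply: continuous_mul; [exact: cst_continuous|exact: mul_continuous_horner].
apply: int01_bound => [|x x01].
  apply: continuous_add; first exact: mul_continuous_horner.
  by apply: continuous_mul; [exact: cst_continuous|exact: mul_continuous_horner].
rewrite mulN1r -mulrBr normrM -mulrA; apply: ler_pM => //.
  by case: (PD j (ltn_ord j)) => _; exact.
case: (LP a) => La0 La.
apply: le_trans (La _ _ (SM' _ x01) (SM _ x01)) _.
by apply: ler_pM => //; exact: SS'.
Qed.

(** Both solutions are curves with coefficients fixed by a map that contracts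
    by 1/2 when [h] is small. *)
Lemma step_unique M : exists2 h0, 0 < h0 & forall h v S S', 0 <= h <= h0 ->
  (forall c, 0 <= c <= 1 -> `|peval S c| <= M) ->
  (forall c, 0 <= c <= 1 -> `|peval S' c| <= M) ->
  spectral_step s f P h v S -> spectral_step s f P h v S' -> S = S'.
Proof.
have [Q Q0 HQ] := step_curve_dist; have [L L0 HL] := step_coefs_lipschitz M.
have LQ0 : 0 <= L * Q by exact: mulr_ge0.
exists (2 * (L * Q + 1))^-1; first by rewrite invr_gt0 mulr_gt0// ltr_wpDl.
move=> h v S S' /andP[h0 hh] SM SM' /spectral_stepP ES /spectral_stepP ES'.
rewrite ES ES'; congr step_curve; apply/eqP; rewrite -subr_eq0 -normr_le0.
set d := `|_|; have d0 : 0 <= d by exact: normr_ge0.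
have : d <= L * (h * Q * d).
  apply: HL => // [|c c01]; first by rewrite !mulr_ge0.
  by rewrite {1}ES {1}ES'; exact: HQ.
have : h * (2 * (L * Q + 1)) <= 1.
  by rewrite -ler_pdivlMr ?mul1r// mulr_gt0// ltr_wpDl.
nra.
Qed.

(** For small [h] the bound [G] on the coefficients keeps the curve within [eps]
    of [v], so the ball of radius [G] is stable under the contraction. *)
Lemma step_exists M eps : 0 < eps -> exists2 h0, 0 < h0 & forall h v,
  0 <= h <= h0 -> `|v| <= M -> exists2 S, spectral_step s f P h v S &
    forall c, 0 <= c <= 1 -> `|peval S c - v| <= eps.
Proof.
move=> eps0.
have [Q Q0 HQ] := step_curve_dist.
have [L L0 HL] := step_coefs_lipschitz (M + eps).
have [G G0 HG] := step_coefs_bound (M + eps).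
have LQ0 : 0 <= L * Q by exact: mulr_ge0.
have QG0 : 0 <= Q * G by exact: mulr_ge0.
pose h1 := (2 * (L * Q + 1))^-1; pose h2 := eps / (Q * G + 1).
have h10 : 0 < h1 by rewrite invr_gt0 mulr_gt0// ltr_wpDl.
have h20 : 0 < h2 by rewrite divr_gt0// ltr_wpDl.
exists (Num.min h1 h2) => [|h v /andP[h0]]; first by rewrite lt_min h10.
rewrite le_min => /andP[hh1 hh2] vM.
have hh1' : h * (2 * (L * Q + 1)) <= 1.
  by rewrite -ler_pdivlMr ?mul1r// mulr_gt0// ltr_wpDl.
have hh2' : h * (Q * G + 1) <= eps by rewrite -ler_pdivlMr// ltr_wpDl.
have near_v gam c : `|gam| <= G -> 0 <= c <= 1 ->
    `|peval (step_curve h v gam) c - v| <= eps.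
  move=> gG c01; have Ev : peval (step_curve h v 0) c = v.
    apply/rowP => a; rewrite !mxE !hornerE horner_sum big1 ?mulr0 ?addr0// => j _.
    by rewrite mxE scale0r horner0.
  rewrite -{2}Ev (le_trans (HQ _ _ _ _ _ _ _))// subr0.
  apply: le_trans hh2'; rewrite -mulrA ler_wpM2l// (le_trans (ler_wpM2l Q0 gG))//.
  by rewrite lerDl.
have in_ball gam c : `|gam| <= G -> 0 <= c <= 1 ->
    `|peval (step_curve h v gam) c| <= M + eps.
  move=> gG c01; rewrite -[peval _ _](subrK v) addrC (le_trans (ler_normD _ _))//.
  by rewrite lerD// near_v.
pose U := [set gam : 'M[R]_(s, m) | `|gam| <= G].
pose Phi gam := step_coefs (step_curve h v gam).
have PhiU : {homo Phi : x / U x >-> U x}.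
  by move=> gam gG; apply: HG => c c01; exact: in_ball.
have ctr : is_contraction (mkfun_fun PhiU).
  exists (2^-1)%:nng; split => [/=|[x x'] /= [Ux Ux']].
    by rewrite invf_lt1// ltr1n.
  apply: (@le_trans _ _ (L * (h * Q * `|x - x'|))).
    apply: HL => [c|c||c c01].
    - exact: in_ball.
    - exact: in_ball.
    - by rewrite !mulr_ge0.
    - exact: HQ.
  have := normr_ge0 (x - x'); set d := `|_|; move: hh1' L0 Q0 h0 LQ0 => *.
  rewrite ler_pdivlMl//; nra.
have clU : closed U.
  rewrite (_ : U = (fun x => `|x|) @^-1` [set x | x <= G])//.
  apply: closed_comp => [u _|]; first exact: norm_continuous.
  exact: closed_le.
have [|gam Ug Eg] := banach_fixed_point ctr clU.
  by exists 0; rewrite /U/= normr0.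
exists (step_curve h v gam) => [|c c01]; last exact: near_v.
by apply/spectral_stepP; congr step_curve.
Qed.

End Solvability.

Section Rescaling.
Variables (R : realType) (m s : nat) (nrm : 'rV[R]_m -> R).
Variables (f : 'rV[R]_m -> 'rV[R]_m) (P : nat -> {poly R}).
Hypothesis orthoP : orthonormal_legendre P.
Implicit Types (v : 'rV[R]_m) (S : 'rV[{poly R}]_m).

(** The change of variable between [sigma(t)] and [S(c) = sigma(c * h)]. *)
Definition rescale (h : R) S : 'rV[{poly R}]_m :=
  map_mx (fun p => p \Po (h *: 'X)) S.

Lemma peval_rescale h S c : peval (rescale h S) c = peval S (c * h).
Proof. by apply/rowP => a; rewrite !mxE horner_comp !hornerE mulrC. Qed.

Lemma rescaleK h : h != 0 -> cancel (rescale h) (rescale h^-1).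
Proof.
move=> h0 S; apply/rowP => a; rewrite !mxE -comp_polyA comp_polyZ comp_polyX.
by rewrite scalerA mulfV// scale1r comp_polyXr.
Qed.

Lemma legendre_step_spectral rho h v sigma :
  legendre_step nrm f P s rho h v sigma ->
  spectral_step s f P h v (rescale h sigma) /\
  forall c, 0 <= c <= 1 -> nrm (peval (rescale h sigma) c - v) <= rho.
Proof.
move=> [ss s0 ds sr]; split => [|c c01]; last first.
  by rewrite peval_rescale; apply: sr; rewrite in_itv.
split; first by rewrite peval_rescale mul0r.
move=> a; rewrite mxE deriv_comp derivZ derivX -scalerAr mulr1; congr (_ *: _).
apply: poly_eq_on01 => c c01.
have cI : c \in `[0, 1] by rewrite in_itv.
have /rowP/(_ a) := ds c cI.
rewrite !mxE horner_comp !hornerE mulrC => ->.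
rewrite summxE horner_sum; apply: eq_bigr => j _; rewrite !mxE hornerZ mulrC.
congr (_ * _); apply: eq_int01 => x _; rewrite peval_rescale//.
Qed.

Lemma spectral_legendre_step rho h v S : h != 0 ->
  spectral_step s f P h v S ->
  (forall c, 0 <= c <= 1 -> nrm (peval S c - v) <= rho) ->
  legendre_step nrm f P s rho h v (rescale h^-1 S).
Proof.
move=> h0 [S0 dS] Sr; have ev c : peval (rescale h^-1 S) (c * h) = peval S c.
  by rewrite peval_rescale mulfK.
split.
- move=> a; rewrite mxE (leq_trans (size_comp_poly_leq _ _))// ltnS.
  have sS := size_step orthoP (dS a).
  apply: (@leq_trans ((size (S 0%R a)).-1 * 1)).
    have sX : ((size (h^-1 *: 'X : {poly R})).-1 <= 1)%N.
      by rewrite -subn1 leq_subLR (leq_trans (size_scale_leq _ _))// size_polyX.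
    by rewrite leq_mul2l sX orbT.
  by rewrite muln1 -subn1 leq_subLR.
- by rewrite peval_rescale mul0r.
- move=> c; rewrite in_itv/= => c01; apply/rowP => a.
  rewrite !mxE deriv_comp derivZ derivX -scalerAr mulr1 hornerZ horner_comp dS.
  rewrite !hornerZ hornerX [h^-1 * (c * h)]mulrCA mulVf// mulr1 mulrA mulVf// mul1r.
  rewrite summxE horner_sum; apply: eq_bigr => j _; rewrite !mxE hornerZ mulrC.
  by congr (_ * _); apply: eq_int01 => x _; rewrite ev.
- by move=> c; rewrite in_itv/= ev; exact: Sr.
Qed.

End Rescaling.

(** * Propagation of the error *)

(** Constants found coordinate by coordinate are replaced by their sum. *)
Lemma uniform_bound (R : realType) (m : nat) (Q : 'I_m -> R -> Prop) :
  (forall b C C', C <= C' -> Q b C -> Q b C') ->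
  (forall b, exists2 C, 0 <= C & Q b C) ->
  exists2 C, 0 <= C & forall b, Q b C.
Proof.
move=> mQ eQ; have /choice[C CP] : forall b, exists C, 0 <= C /\ Q b C.
  by move=> b; have [C] := eQ b; exists C.
exists (\sum_b C b) => [|b]; first by apply: sumr_ge0 => b _; case: (CP b).
have [Cb QC] := CP b; apply: mQ QC.
by rewrite (bigD1 b)//= lerDl sumr_ge0// => i _; case: (CP i).
Qed.

Section OneStep.
Variables (R : realType) (m s : nat) (f : 'rV[R]_m -> 'rV[R]_m).
Variable P : nat -> {poly R}.
Hypothesis orthoP : orthonormal_legendre P.
Hypothesis hs : (0 < s)%N.
Hypothesis sf : forall a, smooth (3 * s) (fun x => f x 0 a).

Let U (tau : R) (x : 'rV[R]_m) : 'rV[R]_m := \row_b taylor_flow f (2 * s) tau b x.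

Let le23 : (2 * s <= 3 * s)%N. Proof. by rewrite leq_mul2r orbT. Qed.
Let lt23 : (2 * s < 3 * s)%N. Proof. by rewrite ltn_mul2r hs. Qed.

(** The estimates on families, applied to the family of all the steps that
    stay in the ball of radius [M], give constants valid for each of them. *)
Lemma local_error M : exists2 C, 0 <= C & forall h v S, 0 < h <= 1 ->
  (forall c, 0 <= c <= 1 -> `|peval S c| <= M) -> spectral_step s f P h v S ->
  `|peval S 1 - U h v| <= C * h ^+ (2 * s).+1 /\
  (forall c, 0 <= c <= 1 -> `|peval S c - U (h * c) v| <= C * h ^+ s.+1).
Proof.
pose good (x : R * 'rV[{poly R}]_m) := [/\ 0 < x.1 <= 1,
  forall c, 0 <= c <= 1 -> `|peval x.2 c| <= M &
  forall a, (x.2 0 a)^`() =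
    x.1 *: legendre_projection P s (fun c => f (peval x.2 c) 0 a)].
pose I := {x | good x}.
pose hI (i : I) := (sval i).1; pose SI (i : I) := (sval i).2.
have h01 i : 0 < hI i <= 1 by case: (svalP i).
have SM i c : 0 <= c <= 1 -> `|peval (SI i) c| <= M by case: (svalP i) => _ + _; exact.
have dS i a : (SI i 0 a)^`() =
    hI i *: legendre_projection P s (fun c => f (peval (SI i) c) 0 a).
  by case: (svalP i) => _ _; exact.
have [C1 C10 H1] := @uniform_bound R m _ (fun b C C' CC' H i =>
    le_trans (H i) (ler_wpM2r (hX_ge0 h01 i (2 * s).+1) CC'))
  (local_error_endpoint orthoP hs sf h01 SM dS).
have [C2 C20 H2] := @uniform_bound R m _ (fun b C C' CC' H i c0 c01 =>
    le_trans (H i c0 c01) (ler_wpM2r (hX_ge0 h01 i s.+1) CC'))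
  (local_error_uniform orthoP hs sf h01 SM dS).
exists (C1 + C2) => [|h v S hh SM' [S0 dS']]; first exact: addr_ge0.
have gi : good (h, S) by [].
have h0 : 0 <= h by case/andP: hh => /ltW.
split => [|c c01]; apply: rV_norm_le => [|b].
- by rewrite mulr_ge0 ?addr_ge0// exprn_ge0.
- rewrite !mxE; have := H1 b (exist _ (h, S) gi).
  rewrite /hI /SI/= S0 mxE => /le_trans; apply.
  by rewrite ler_wpM2r ?exprn_ge0// lerDl.
- by rewrite mulr_ge0 ?addr_ge0// exprn_ge0.
- rewrite !mxE; have := H2 b (exist _ (h, S) gi) c c01.
  rewrite /hI /SI/= S0 mxE => /le_trans; apply.
  by rewrite ler_wpM2r ?exprn_ge0// lerDr.
Qed.

Lemma flow_lipschitz M : exists2 L, 0 <= L & forall x x' tau,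
  `|x| <= M -> `|x'| <= M -> 0 <= tau <= 1 ->
  `|(U tau x' - x') - (U tau x - x)| <= tau * L * `|x' - x|.
Proof.
have [|L L0 HL] := @uniform_bound R m _ _ (taylor_flow_lipschitz sf le23 M).
  move=> b L L' LL' H x x' tau xM x'M tau01.
  apply: le_trans (H x x' tau xM x'M tau01) _.
  by case/andP: tau01 => tau0 _; rewrite ler_wpM2r// ler_wpM2l.
exists L => // x x' tau xM x'M tau01; apply: rV_norm_le => [|b].
  by case/andP: tau01 => tau0 _; rewrite !mulr_ge0.
by rewrite !mxE; exact: HL.
Qed.

Variables (t0 T : R) (y0 : 'rV[R]_m) (y : R -> 'rV[R]_m).
Hypothesis solP : is_solution f t0 T y0 y.

Lemma exact_error M : (forall t, t0 <= t <= T -> `|y t| <= M) ->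
  exists2 C, 0 <= C & forall t tau, t0 <= t -> 0 <= tau <= 1 -> t + tau <= T ->
    `|y (t + tau) - U tau (y t)| <= C * tau ^+ (2 * s).+1.
Proof.
move=> yM.
have [|C C0 HC] := @uniform_bound R m _ _ (fun b => exact_taylor_error solP sf lt23 b yM).
  move=> b C C' CC' H t tau tt tau01 tT; apply: le_trans (H t tau tt tau01 tT) _.
  by case/andP: tau01 => tau0 _; rewrite ler_wpM2r// exprn_ge0.
exists C => // t tau tt tau01 tT; apply: rV_norm_le => [|b].
  by case/andP: tau01 => tau0 _; rewrite mulr_ge0// exprn_ge0.
by rewrite !mxE; exact: HC.
Qed.

(** Exact solution and numerical step are both close to [U]; the difference of
    the two starting points is transported by [U]. *)
Lemma one_step_estimates M : (forall t, t0 <= t <= T -> `|y t| <= M) ->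
  exists B L : R, [/\ 0 <= B, 0 <= L & forall h t v S,
    0 < h <= 1 -> t0 <= t -> t + h <= T ->
    (forall c, 0 <= c <= 1 -> `|peval S c| <= M) -> spectral_step s f P h v S ->
    `|(y (t + h) - peval S 1) - (y t - v)| <= B * h ^+ (2 * s).+1 + h * L * `|y t - v| /\
    (forall c, 0 <= c <= 1 ->
      `|y (t + c * h) - peval S c| <= B * h ^+ s.+1 + (1 + L) * `|y t - v|)].
Proof.
move=> yM; have [C1 C10 H1] := local_error M; have [L L0 HL] := flow_lipschitz M.
have [C2 C20 H2] := exact_error yM.
exists (C2 + C1), L; split; [exact: addr_ge0|by []|].
move=> h t v S hh tt tT SM stepS; have [E1 E2] := H1 h v S hh SM stepS.
have /andP[h0 h1] := hh.
have vM : `|v| <= M by have [<- _] := stepS; apply: SM; rewrite lexx ler01.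
have ytM : `|y t| <= M by apply: yM; apply/andP; split; lra.
split => [|c c01].
  have -> : y (t + h) - peval S 1 - (y t - v) = (y (t + h) - U h (y t)) -
      (peval S 1 - U h v) + ((U h (y t) - y t) - (U h v - v)).
    by apply/rowP => b; rewrite !mxE; ring.
  rewrite (le_trans (ler_normD _ _))// lerD//; last by apply: HL => //; rewrite ltW.
  rewrite mulrDl (le_trans (ler_normB _ _))// lerD//.
  by apply: H2 => //; rewrite ltW.
have /andP[c0 c1] := c01.
have tau0 : 0 <= h * c by rewrite mulr_ge0// ltW.
have tauh : h * c <= h by rewrite ler_piMr// ltW.
have tau1 : 0 <= h * c <= 1 by rewrite tau0 (le_trans tauh).
have -> : y (t + c * h) - peval S c = (y (t + h * c) - U (h * c) (y t)) -
    (peval S c - U (h * c) v) +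
    (((U (h * c) (y t) - y t) - (U (h * c) v - v)) + (y t - v)).
  by apply/rowP => b; rewrite [c * h]mulrC !mxE; ring.
rewrite (le_trans (ler_normD _ _))// lerD//; last first.
  rewrite (le_trans (ler_normD _ _))// [1 + L]addrC mulrDl mul1r lerD//.
  apply: le_trans (HL _ _ _ vM ytM tau1) _.
  by rewrite ler_wpM2r// ler_piMl//; case/andP: tau1.
rewrite mulrDl (le_trans (ler_normB _ _))// lerD//; last exact: E2.
apply: le_trans (H2 _ _ tt tau1 _) _; first by rewrite (le_trans _ tT)// lerD2l.
rewrite ler_wpM2l//; apply: (@le_trans _ _ (h ^+ (2 * s).+1)).
  by rewrite lerXn2r// nnegrE// ltW.
by rewrite ler_wiXn2l// ?ltW// ltnS leq_pmull.
Qed.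

End OneStep.

Lemma gronwall_factor (R : realType) (a : R) n : 0 <= a ->
  (1 + a) ^+ n <= expR (n%:R * a).
Proof.
move=> a0; rewrite expRM_natl lerXn2r// ?nnegrE ?addr_ge0// ?expR_ge0//.
exact: expR_ge1Dx.
Qed.

(** The recursion is required only where the claimed bound already holds, because
    it is this bound that keeps the numerical solution in the region where
    the one-step estimates apply. *)
Lemma discrete_gronwall (R : realType) (err : nat -> R) (a b : R) N :
  0 <= a -> 0 <= b -> err 0%N = 0 ->
  (forall n, (n < N)%N -> err n <= n%:R * (1 + a) ^+ n * b ->
    err n.+1 <= (1 + a) * err n + b) ->
  forall n, (n <= N)%N -> err n <= n%:R * (1 + a) ^+ n * b.
Proof.
move=> a0 b0 err0 errS; elim=> [_|n IHn nN]; first by rewrite err0 !mul0r.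
have En := IHn (ltnW nN); apply: le_trans (errS n nN En) _.
have a1 : 0 <= 1 + a by rewrite addr_ge0.
apply: (@le_trans _ _ ((1 + a) * (n%:R * (1 + a) ^+ n * b) + b)).
  by rewrite lerD2r ler_wpM2l.
have -> : (1 + a) * (n%:R * (1 + a) ^+ n * b) = n%:R * (1 + a) ^+ n.+1 * b.
  by rewrite exprS; ring.
rewrite -[n.+1%:R]natr1 [in leRHS]mulrDl mul1r [in leRHS]mulrDl lerD2l.
by rewrite ler_peMl// exprn_ege1// lerDl.
Qed.

Theorem theorem4 (R : realType) (s : nat) (hs : (0 < s)%N) :
  exists k : nat,
  forall (m : nat) (nrm : 'rV[R]_m -> R) (f : 'rV[R]_m -> 'rV[R]_m)
    (P : nat -> {poly R}) (t0 T : R) (y0 : 'rV[R]_m) (y : R -> 'rV[R]_m),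
  is_vnorm nrm ->
  class_C k f ->
  orthonormal_legendre P ->
  t0 < T ->
  is_solution f t0 T y0 y ->
  forall rho : R, 0 < rho ->
  exists (N0 : nat) (C : R), forall N : nat, (N0 <= N)%N ->
  let h := (T - t0) / N%:R in
  let t := fun n : nat => t0 + n%:R * h in
  exists sigma : nat -> 'rV[{poly R}]_m,
  let yn := grid_value y0 h sigma in
  [/\ legendre_method nrm f P s rho h y0 N sigma,
      forall tau, legendre_method nrm f P s rho h y0 N tau ->
        forall n, (0 < n <= N)%N -> tau n = sigma n &
      forall n, (0 < n <= N)%N ->
        nrm ((y (t n) - yn n) - (y (t n.-1) - yn n.-1))
          <= C * h ^+ (2 * s).+1 /\
        maxnorm nrm (fun c => y (t n.-1 + c * h) - peval (sigma n) (c * h))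
          <= C * h ^+ s.+1].
Proof.
exists (3 * s)%N => m nrm f P t0 T y0 y nrmP Cf orthoP t0T solP rho rho0.
have sf a : smooth (3 * s) (fun x => f x 0 a) by exact: class_C_smooth.
have sf1 a : smooth 1 (fun x => f x 0 a).
  by apply: smooth_le (sf a); rewrite muln_gt0.
have [M0 M00 yM0] := solution_bounded solP t0T.
have [C1 C10 HC1] := vnorm_le_sup nrmP; have [C2 C20 HC2] := sup_le_vnorm nrmP.
(* The exact solution has norm at most [M0], the grid values at most [M], and
   the steps, which may leave their start by [rho], at most [M2]. *)
pose M := M0 + 1; pose M2 := M + C2 * rho.
have C2rho : 0 <= C2 * rho by rewrite mulr_ge0// ltW.
have MM2 : M <= M2 by rewrite lerDl.
have yM2 t : t0 <= t <= T -> `|y t| <= M2.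
  by move=> /yM0 H; rewrite (le_trans H)// (le_trans _ MM2)// lerDl.
have [B [L [B0 L0 Hstep]]] := one_step_estimates orthoP hs sf solP yM2.
(* In the norm [nrm] a step within [eps] of its start stays within [rho]. *)
pose eps := rho / (C1 + 1).
have eps0 : 0 < eps by rewrite divr_gt0// ltr_wpDl.
have [hA hA0 HA] := step_exists s orthoP sf1 M eps0.
have [hB hB0 HB] := step_unique s orthoP sf1 M2.
(* The global error is at most [D h^2s]; [h0] makes this at most 1. *)
pose D := expR (L * (T - t0)) * (T - t0) * B.
have Tt0 : 0 < T - t0 by rewrite subr_gt0.
have D0 : 0 <= D by rewrite !mulr_ge0 ?expR_ge0// ltW.
pose h0 := Num.min (Num.min hA hB) (1 / (D + 1)).
have h00 : 0 < h0 by rewrite !lt_min hA0 hB0 divr_gt0// ltr_wpDl.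
exists (Num.bound ((T - t0) / h0)).
exists (C1 * (B + L * D + (1 + L) * D)) => N N0N h t.
have N0 : (0 : R) < N%:R.
  have := archi_boundP (ltW (divr_gt0 Tt0 h00)).
  move=> H; apply: (@lt_le_trans _ _ (Num.bound ((T - t0) / h0))%:R).
    by rewrite (lt_trans _ H)// divr_gt0.
  by rewrite ler_nat.
have hp : 0 < h by rewrite divr_gt0.
have hh0 : h <= h0.
  rewrite /h ler_pdivrMr// mulrC -ler_pdivrMr//.
  rewrite (le_trans (ltW (archi_boundP (ltW (divr_gt0 Tt0 h00)))))//.
  by rewrite ler_nat.
move: (hh0); rewrite !le_min => /andP[/andP[hhA hhB] hhD].
have hD : h * (D + 1) <= 1 by rewrite -ler_pdivlMr// ltr_wpDl.
have h1 : h <= 1 by nra.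
have h01 : 0 < h <= 1 by rewrite hp h1.
have hn0 : h != 0 by rewrite gt_eqF.
have hX k : 0 <= h ^+ k by rewrite exprn_ge0// ltW.
have Nh : N%:R * h = T - t0 by rewrite /h mulrCA mulfV ?mulr1// gt_eqF.
have nh n : (n <= N)%N -> n%:R * h <= T - t0.
  by move=> nN; rewrite -Nh ler_wpM2r ?ler_nat// ltW.
have tI n : (n <= N)%N -> t0 <= t n <= T.
  by move=> nN; rewrite /t lerDl -lerBrDl nh// andbT mulr_ge0// ltW.
have tS n : t n.+1 = t n + h by rewrite /t -natr1; ring.
have /choice[Phi PhiP] : forall v, exists sg, `|v| <= M ->
    legendre_step nrm f P s rho h v sg.
  move=> v; have [vM|] := pselect (`|v| <= M); last by exists 0.
  have [|S stepS Sv] := HA h v _ vM; first by rewrite ltW.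
  exists (rescale h^-1 S) => _.
  apply: (spectral_legendre_step orthoP hn0 stepS) => c c01.
  apply: le_trans (HC1 _) _; apply: (@le_trans _ _ (C1 * eps)).
    by rewrite ler_wpM2l// Sv.
  have C1p : 0 < C1 + 1 by rewrite ltr_wpDl.
  by rewrite /eps mulrCA (ler_piMr (ltW rho0))// (ler_pdivrMr _ _ C1p) mul1r lerDl.
have in_ball v sg : `|v| <= M -> legendre_step nrm f P s rho h v sg ->
    spectral_step s f P h v (rescale h sg) /\
    forall c, 0 <= c <= 1 -> `|peval (rescale h sg) c| <= M2.
  move=> vM /legendre_step_spectral[stepS Sr]; split => // c c01.
  rewrite -[peval _ _](subrK v) addrC (le_trans (ler_normD _ _))// lerD//.
  by rewrite (le_trans (HC2 _))// ler_wpM2l// Sr.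
(* The grid values, and the steps that start from them. *)
pose v n := iter n (fun x => peval (Phi x) h) y0.
pose sigma n := Phi (v n.-1).
have gv n : grid_value y0 h sigma n = v n by case: n.
pose bound n : R := n%:R * (1 + h * L) ^+ n * (B * h ^+ (2 * s).+1).
have boundD n : (n <= N)%N -> bound n <= D * h ^+ (2 * s).
  move=> nN; rewrite /bound /D exprS.
  have hL : 0 <= h * L by rewrite mulr_ge0// ltW.
  have E1 : (1 + h * L) ^+ n <= expR (L * (T - t0)).
    apply: le_trans (gronwall_factor n hL) _; rewrite ler_expR mulrA mulrC.
    by rewrite ler_wpM2l// nh.
  have -> : n%:R * (1 + h * L) ^+ n * (B * (h * h ^+ (2 * s))) =
    (1 + h * L) ^+ n * (n%:R * h) * B * h ^+ (2 * s) by ring.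
  rewrite ler_wpM2r// ler_wpM2r//; apply: ler_pM => //; last exact: nh.
    by rewrite exprn_ge0// addr_ge0.
  by rewrite mulr_ge0// ltW.
have Dh : D * h ^+ (2 * s) <= 1.
  apply: (@le_trans _ _ (D * h)); last by nra.
  rewrite ler_wpM2l// -[leRHS]expr1 ler_wiXn2l ?(ltW hp)//.
  by rewrite muln_gt0.
have near_y n : (n <= N)%N -> `|y (t n) - v n| <= bound n -> `|v n| <= M.
  move=> nN /le_trans/(_ (boundD n nN))/le_trans/(_ Dh) H.
  rewrite -[v n](subrK (y (t n))) addrC (le_trans (ler_normD _ _))// lerD//.
    exact/yM0/tI.
  by rewrite distrC.
have stepP n : (n < N)%N -> `|v n| <= M ->
    `|(y (t n.+1) - v n.+1) - (y (t n) - v n)|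
       <= B * h ^+ (2 * s).+1 + h * L * `|y (t n) - v n| /\
    (forall c, 0 <= c <= 1 -> `|y (t n + c * h) - peval (Phi (v n)) (c * h)|
       <= B * h ^+ s.+1 + (1 + L) * `|y (t n) - v n|).
  move=> nN vM; have [stepS SM2] := in_ball _ _ vM (PhiP _ vM).
  have /andP[tn _] := tI _ (ltnW nN); have /andP[_ tn1] := tI _ nN.
  rewrite tS in tn1.
  have [E1 E2] := Hstep h (t n) (v n) _ h01 tn tn1 SM2 stepS.
  split => [|c c01]; last by rewrite -peval_rescale; exact: E2.
  by move: E1; rewrite peval_rescale mul1r tS.
have err n : (n <= N)%N -> `|y (t n) - v n| <= bound n.
  move: n; apply: (@discrete_gronwall _ (fun n => `|y (t n) - v n|)
    (h * L) (B * h ^+ (2 * s).+1)) => [|||n nN En].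
  - by rewrite mulr_ge0// ltW.
  - exact: mulr_ge0.
  - by rewrite /t mul0r addr0 /v/= (proj1 solP) subrr normr0.
  have [E1 _] := stepP n nN (near_y n (ltnW nN) En).
  rewrite -[y _ - _](subrK (y (t n) - v n)) (le_trans (ler_normD _ _))//.
  apply: (le_trans (lerD E1 (lexx _))); rewrite le_eqVlt; apply/orP; left; apply/eqP.
  by ring.
have vM n : (n <= N)%N -> `|v n| <= M by move=> nN; apply: near_y => //; exact: err.
have errD n : (n <= N)%N -> `|y (t n) - v n| <= D * h ^+ (2 * s).
  by move=> nN; exact: le_trans (err n nN) (boundD n nN).
exists sigma => yn; split.
- move=> [//|n] /= nN; rewrite gv; apply/PhiP/vM; exact: ltnW.
- move=> tau tauP.
  suff H n : (n <= N)%N -> grid_value y0 h tau n = v n /\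
      ((0 < n)%N -> tau n = sigma n).
    by move=> n /andP[n0 nN]; case: (H n nN) => _; exact.
  elim: n => [//|n IHn nN]; have [En _] := IHn (ltnW nN).
  have := tauP n.+1 nN; rewrite /= En => stepT.
  have vn := vM n (ltnW nN).
  suff E : tau n.+1 = sigma n.+1 by rewrite /= E.
  have [s1 b1] := in_ball _ _ vn stepT.
  have [s2 b2] := in_ball _ _ vn (PhiP _ vn).
  apply: (can_inj (rescaleK hn0)).
  by apply: (HB h (v n)) => //; rewrite ltW.
- move=> [//|n] nN; rewrite /yn !gv /=.
  have [E1 E2] := stepP n nN (vM n (ltnW nN)).
  have En := errD n (ltnW nN).
  have LD0 : 0 <= L * D by exact: mulr_ge0.
  have LD1 : 0 <= (1 + L) * D by rewrite mulr_ge0// addr_ge0.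
  split.
    rewrite (le_trans (HC1 _))// -mulrA ler_wpM2l// (le_trans E1)//.
    rewrite -addrA mulrDl lerD2l mulrDl -mulrA.
    apply: (@le_trans _ _ (h * (L * (D * h ^+ (2 * s))))).
      by rewrite ler_wpM2l ?(ltW hp)// ler_wpM2l.
    rewrite exprS.
    have -> : h * (L * (D * h ^+ (2 * s))) = L * D * (h * h ^+ (2 * s)) by ring.
    by rewrite lerDl mulr_ge0// mulr_ge0// ltW.
  apply: ge_sup.
    exists (nrm (y (t n + 0 * h) - peval (sigma n.+1) (0 * h))).
    by exists 0 => //=; rewrite in_itv/= lexx ler01.
  move=> _ [c /= + <-]; rewrite in_itv/= => c01.
  rewrite (le_trans (HC1 _))// -mulrA ler_wpM2l// (le_trans (E2 c c01))//.
  have hs1 : h ^+ (2 * s) <= h ^+ s.+1.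
    by rewrite ler_wiXn2l ?(ltW hp)// mul2n -addnn -addn1 leq_add2l.
  have -> : (B + L * D + (1 + L) * D) * h ^+ s.+1 =
      B * h ^+ s.+1 + ((1 + L) * D * h ^+ s.+1 + L * D * h ^+ s.+1) by ring.
  rewrite lerD2l; apply: (@le_trans _ _ ((1 + L) * D * h ^+ s.+1)); last first.
    by rewrite lerDl mulr_ge0.
  rewrite -mulrA ler_wpM2l ?addr_ge0// (le_trans En)// ler_wpM2l//.
Qed.
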